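(* For all integers $n\ge0$ and $\alpha\ge0$: \begin{align*} &\overline{S_9}(12n+7)\equiv0\pmod 8,\\ &\overline{S_9}(6n+3)\equiv(-1)^\alpha\,\overline{S_9}(3^\alpha(6n+3))\pmod{16},\\ &\overline{S_9}(6n+5)\equiv\overline{S_9}(3^\alpha(6n+5))\pmod{16},\\ &\overline{S_9}(24n+23)\equiv0\pmod{32}. \end{align*}
   Context: For $|q|<1$ and a positive integer $k$, write $f_k=\prod_{j\ge1}(1-q^{kj})$. The function $\overline{S_9}(n)$ (number of $9$-Schur overpartitions of $n$) is defined by $\sum_{n\ge0}\overline{S_9}(n)q^n=\prod_{n\ge1}\frac{(1+q^{2n-1})(1-q^{9(2n-1)})}{(1+q^{9(2n-1)})(1-q^{2n-1})}=\frac{f_2^3f_9^2f_{36}}{f_1^2f_4f_{18}^3}$. *)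

(* Defs.v *)
From HB Require Import structures.
From mathcomp Require Import all_boot all_order all_algebra.
Set Implicit Arguments.
Unset Strict Implicit.
Unset Printing Implicit Defensive.
Import Order.TTheory GRing.Theory Num.Theory.
Local Open Scope ring_scope.

(* Generating functions are read in Z[[q]], with 'X for q.  For D with        *)
(* constant term 1, 1/D = \sum_k (1 - D)^k there, and the terms with k > n do *)
(* not reach q^n; so this is the coefficient of q^n in N / D (expandP).       *)
Definition expand (N D : {poly int}) (n : nat) : int :=
  (N * \sum_(k < n.+1) (1 - D) ^+ k)`_n.

Definition schur9_num (M : nat) : {poly int} :=
  \prod_(1 <= j < M.+1)
     ((1 + 'X^(2 * j - 1)) * (1 - 'X^(9 * (2 * j - 1)))).

Definition schur9_den (M : nat) : {poly int} :=
  \prod_(1 <= j < M.+1)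
     ((1 + 'X^(9 * (2 * j - 1))) * (1 - 'X^(2 * j - 1))).

(* The coefficient of q^n in the infinite product: every partial product of   *)
(* at least n factors has the same one (S9bar_stable).                        *)
Definition S9bar (n : nat) : int := expand (schur9_num n) (schur9_den n) n.

Section Eqm.
Variable n : nat.

Definition eqm (p q : {poly int}) := exists r, p = q + r * 'X^(n.+1).

Lemma eqm_refl p : eqm p p.
Proof. by exists 0; rewrite mul0r addr0. Qed.

Lemma eqmM p q p' q' : eqm p q -> eqm p' q' -> eqm (p * p') (q * q').
Proof.
move=> [r ->] [r' ->]; exists (q * r' + r * q' + r * r' * 'X^(n.+1)).
rewrite mulrDl !mulrDr !mulrDl !addrA -!mulrA.
by rewrite ['X^(n.+1) * q']mulrC ['X^(n.+1) * (r' * _)]mulrCA.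
Qed.

Lemma eqmD p q p' q' : eqm p q -> eqm p' q' -> eqm (p + p') (q + q').
Proof. by move=> [r ->] [r' ->]; exists (r + r'); rewrite mulrDl addrACA. Qed.

Lemma eqmN p q : eqm p q -> eqm (- p) (- q).
Proof. by move=> [r ->]; exists (- r); rewrite mulNr opprD. Qed.

Lemma eqmX p q k : eqm p q -> eqm (p ^+ k) (q ^+ k).
Proof.
move=> pq; elim: k => [|k IH]; first by rewrite !expr0; apply: eqm_refl.
by rewrite !exprS; apply: eqmM.
Qed.

Lemma eqm_sum (I : Type) (s : seq I) (F G : I -> {poly int}) :
  (forall i, eqm (F i) (G i)) -> eqm (\sum_(i <- s) F i) (\sum_(i <- s) G i).
Proof.
by move=> FG; apply: (big_ind2 eqm) => // *; [apply: eqm_refl | apply: eqmD].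
Qed.

Lemma eqm_coef p q m : (m <= n)%N -> eqm p q -> p`_m = q`_m.
Proof. by move=> le_mn [r ->]; rewrite coefD coefMXn ltnS le_mn addr0. Qed.

Lemma eqm1_Xn k : (n < k)%N -> eqm (1 + 'X^k) 1 /\ eqm (1 - 'X^k) 1.
Proof.
move=> lt_nk; have -> : 'X^k = 'X^(k - n.+1) * 'X^(n.+1) :> {poly int}.
  by rewrite -exprD subnK.
by split; [exists ('X^(k - n.+1)) | exists (- 'X^(k - n.+1)); rewrite mulNr].
Qed.

End Eqm.

Lemma coef_expr_lt (u : {poly int}) k m :
  u`_0 = 0 -> (m < k)%N -> forall p : {poly int}, (p * u ^+ k)`_m = 0.
Proof.
move=> u0 lt_mk p; have : root u 0 by rewrite /root horner_coef0 u0.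
case/factor_theorem => v ->; rewrite subr0 exprMn mulrA coefMXn.
by rewrite lt_mk.
Qed.

Lemma expand_trunc (N D : {poly int}) n m :
  D`_0 = 1 -> (m <= n)%N ->
  expand N D m = (N * \sum_(k < n.+1) (1 - D) ^+ k)`_m.
Proof.
move=> D0; elim: n => [|n IH]; first by rewrite leqn0 => /eqP->.
rewrite leq_eqVlt => /predU1P[-> //|]; rewrite ltnS => le_mn.
rewrite IH // [in RHS]big_ord_recr /= mulrDr coefD.
by rewrite (coef_expr_lt (u := 1 - D)) ?addr0 // coefB coef1 D0 subrr.
Qed.

Lemma expandP (N D : {poly int}) (n : nat) : D`_0 = 1 ->
  \sum_(i < n.+1) D`_i * expand N D (n - i) = N`_n.
Proof.
move=> D0; pose G := N * \sum_(k < n.+1) (1 - D) ^+ k.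
transitivity (D * G)`_n.
  rewrite coefM; apply: eq_bigr => i _.
  by rewrite (expand_trunc _ D0 (leq_subr i n)).
have -> : D * G = N - N * (1 - D) ^+ n.+1.
  have DE : D = - (1 - D - 1) by rewrite addrAC subrr sub0r opprK.
  by rewrite /G mulrCA [X in X * \sum_(k < _) _]DE mulNr -subrX1 opprB mulrBr mulr1.
by rewrite coefB (coef_expr_lt (u := 1 - D)) ?subr0 // coefB coef1 D0 subrr.
Qed.

Lemma schur9_den0 M : (schur9_den M)`_0 = 1.
Proof.
rewrite -horner_coef0 /schur9_den horner_prod big_nat big1 // => j /andP[j1 _].
have : (0 < 2 * j - 1)%N by rewrite subn_gt0; case: j j1 => // j _; rewrite mulnS.
case: (2 * j - 1)%N => // m _.
by rewrite mulnS !hornerE !expr0n /= ?oppr0 !addr0 ?mulr1.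
Qed.

Lemma S9bar_stable (M n : nat) : (n <= M)%N ->
  expand (schur9_num M) (schur9_den M) n = S9bar n.
Proof.
move=> le_nM; suff [eN eD] : eqm n (schur9_num M) (schur9_num n) /\
                             eqm n (schur9_den M) (schur9_den n).
  apply: (eqm_coef (leqnn n)); apply: eqmM => //; apply: eqm_sum => k.
  by apply/eqmX/eqmD; [apply: eqm_refl | apply: eqmN].
rewrite -(subnKC le_nM); elim: (M - n)%N => [|d [IHN IHD]].
  by rewrite addn0; split; apply: eqm_refl.
rewrite addnS /schur9_num /schur9_den !(big_nat_recr (n + d).+1) //=.
have lt1 : (n < 2 * (n + d).+1 - 1)%N.
  by rewrite mul2n -addnn addSn subn1 /= addnS ltnS -addnA leq_addr.
have lt9 : (n < 9 * (2 * (n + d).+1 - 1))%N by apply: leq_trans lt1 (leq_pmull _ _).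
have [a1 b1] := eqm1_Xn lt1; have [a9 b9] := eqm1_Xn lt9.
have E1 p q : eqm n p 1 -> eqm n q 1 -> eqm n (p * q) 1.
  by move=> p1 q1; have := eqmM p1 q1; rewrite mulr1.
by split; rewrite -[X in eqm _ _ X]mulr1; apply: eqmM => //; apply: E1.
Qed.

(* Main.v *)
(* Write phi(q) = \sum q^(n^2), E for the Euler product, A and psi for the theta      *)
(* functions f(q, q^2) and f(q, q^3), Om(q) = \sum q^(3 n^2 - 2 n) and S for the      *)
(* generating function.  The triple product gives                                     *)
(*   S(q) phi(-q^2) phi(q^9) = phi(q) phi(-q^18).                                     *)
(* Inserting phi(q) = phi(q^9) + 2 q Om(q^3), clearing denominators and using         *)
(* Om(q) phi(-q^3) = E(q^4)^2 + q Om(-q^2)^2 to split off parity, one finds, with     *)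
(* b = phi(-q^3), z = Om(-q), y = E(q^2)^2 and d = b^3 - 8 q z^3,                     *)
(*   \sum S(6n+1) q^n = 2 y b / d,        \sum S(6n+3) q^n = 4 y z / d,               *)
(*   \sum S(6n+5) q^n = 8 y z^2 / (b d).                                              *)
(* As b = 1 mod 2, these are 2 y mod 8, 4 y z b mod 32 and 8 y z^2 mod 64.  The       *)
(* product y z b factors as phi(-q) psi(q) times its image under q -> q^3, so its     *)
(* 3-dissection follows from those of phi and psi: the sections of index 1 and 2      *)
(* are - y z b and - 2 y z^2.  Finally y has even exponents only, and so has every    *)
(* square modulo 2.                                                                   *)

Require Import Defs.
From HB Require Import structures.
From mathcomp Require Import all_boot all_order all_algebra.
From mathcomp Require Import boolp.
From mathcomp Require Import ring zify.
Set Implicit Arguments.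
Unset Strict Implicit.
Unset Printing Implicit Defensive.
Import GRing.Theory.
Local Open Scope ring_scope.

(** * Formal power series *)

(** The generating function is a quotient of theta functions ([S9_theta]), so dissecting modulo 3
    and then modulo 2 gives its progressions modulo 6 exactly ([S9_sect_6_1], [S9_sect_6_3],
    [S9_sect_6_5]). Their denominators are built from b = phi(-q^3), which is 1 modulo 2, and
    collapse modulo small powers of 2.

    What drives the powers of 3 is a self-similarity: y z b = G(q) G(q^3) with G = phi(-q) psi(q)
    ([yzb_phi_psi]), so a 3-section of y z b is a 3-section of G times G itself. Index 1 returns - y
    z b, index 2 returns - 2 y z^2 ([sect_yzb_1], [sect_yzb_2]). Hence S(18n+9) = - S(6n+3) mod 32
    and S(18n+15) = S(6n+5) mod 16; iterating the first congruence yields both families in alpha.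

    For 12n+7 the leading term 2 y has no odd exponents. For 24n+23, two successive odd sections of
    y z^2 each contribute a factor 2, because modulo 2 a square has even exponents only
    ([sect_yzz]).

    Everything is formal in Z[[q]]: limits are checked degree by degree, and cancelling a series of
    constant term 1 ([lreg1]) replaces most divisions. *)

Definition fps := nat -> int.

HB.instance Definition _ := gen_eqMixin fps.
HB.instance Definition _ := gen_choiceMixin fps.

Section Ring.
Implicit Types f g h : fps.

Lemma fpsP f g : f =1 g -> f = g.
Proof. exact: funext. Qed.

Definition trunc n f : {poly int} := \poly_(i < n) f i.

Lemma coef_trunc n f k : (k < n)%N -> (trunc n f)`_k = f k.
Proof. by move=> lt_kn; rewrite coef_poly lt_kn. Qed.

Definition fps_add f g : fps := fun n => f n + g n.
Definition fps_opp f : fps := fun n => - f n.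
(** Going through truncated polynomials lets the ring axioms be inherited from [{poly int}]. *)
Definition fps_mul f g : fps := fun n => (trunc n.+1 f * trunc n.+1 g)`_n.
Definition fps_one : fps := fun n => (n == 0%N)%:R.

Lemma coefM_agree n (p p' r r' : {poly int}) :
  (forall k, (k <= n)%N -> p`_k = p'`_k) ->
  (forall k, (k <= n)%N -> r`_k = r'`_k) -> (p * r)`_n = (p' * r')`_n.
Proof.
move=> pp' rr'; rewrite !coefM; apply: eq_bigr => i _.
by rewrite pp' -1?ltnS ?rr' // leq_subr.
Qed.

Lemma fps_mul_trunc n k f g : (k < n)%N ->
  fps_mul f g k = (trunc n f * trunc n g)`_k.
Proof.
move=> lt_kn; apply: coefM_agree => i le_ik;
  by rewrite !coef_trunc // (leq_ltn_trans le_ik).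
Qed.

Fact fps_addA : associative fps_add.
Proof. by move=> f g h; apply: fpsP => n; rewrite /fps_add addrA. Qed.
Fact fps_addC : commutative fps_add.
Proof. by move=> f g; apply: fpsP => n; rewrite /fps_add addrC. Qed.
Fact fps_add0 : left_id (fun=> 0 : int) fps_add.
Proof. by move=> f; apply: fpsP => n; rewrite /fps_add add0r. Qed.
Fact fps_addN : left_inverse (fun=> 0 : int) fps_opp fps_add.
Proof. by move=> f; apply: fpsP => n; rewrite /fps_add addNr. Qed.

HB.instance Definition _ :=
  GRing.isZmodule.Build fps fps_addA fps_addC fps_add0 fps_addN.

Fact fps_mulA : associative fps_mul.
Proof.
move=> f g h; apply: fpsP => n.
transitivity (trunc n.+1 f * (trunc n.+1 g * trunc n.+1 h))`_n.
  apply: coefM_agree => // k le_kn.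
  by rewrite [LHS]coef_trunc ?ltnS // (fps_mul_trunc (n := n.+1)).
rewrite mulrA; apply: coefM_agree => // k le_kn.
by rewrite [RHS]coef_trunc ?ltnS // (fps_mul_trunc (n := n.+1)).
Qed.
Fact fps_mulC : commutative fps_mul.
Proof. by move=> f g; apply: fpsP => n; rewrite /fps_mul mulrC. Qed.
Fact fps_mul1 : left_id fps_one fps_mul.
Proof.
move=> f; apply: fpsP => n; rewrite -[RHS](@coef_trunc n.+1) // -[in RHS](mul1r (trunc _ f)).
by apply: coefM_agree => // k le_kn; rewrite coef_trunc // coef1.
Qed.
Fact fps_mulDl : left_distributive fps_mul +%R.
Proof.
move=> f g h; apply: fpsP => n.
transitivity ((trunc n.+1 f + trunc n.+1 g) * trunc n.+1 h)`_n.
  by apply: coefM_agree => // k le_kn; rewrite coefD !coef_trunc.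
by rewrite mulrDl coefD.
Qed.
Fact fps_1neq0 : fps_one != 0.
Proof. by apply/eqP => /(congr1 (@^~ 0%N)). Qed.

HB.instance Definition _ := GRing.Zmodule_isComNzRing.Build fps
  fps_mulA fps_mulC fps_mul1 fps_mulDl fps_1neq0.

Lemma fpsD f g n : (f + g) n = f n + g n. Proof. by []. Qed.
Lemma fpsN f n : (- f) n = - f n. Proof. by []. Qed.
Lemma fps0 n : (0 : fps) n = 0. Proof. by []. Qed.
Lemma fps1 n : (1 : fps) n = (n == 0%N)%:R. Proof. by []. Qed.

Lemma fpsMn f k n : (f *+ k) n = f n *+ k.
Proof. by elim: k => [|k IH] //; rewrite !mulrSr fpsD IH. Qed.

Lemma fps_sum (I : Type) (s : seq I) P (F : I -> fps) n :
  (\sum_(i <- s | P i) F i) n = \sum_(i <- s | P i) F i n.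
Proof. exact: (big_morph (fun f : fps => f n) (fun f g => fpsD f g n) (fps0 n)). Qed.

Lemma fpsM f g n : (f * g) n = \sum_(i < n.+1) f i * g (n - i)%N.
Proof.
rewrite [LHS]/(fps_mul f g n) /fps_mul coefM; apply: eq_bigr => i _.
by rewrite !coef_trunc // ltnS leq_subr.
Qed.

Lemma fpsM0 f g : (f * g) 0%N = f 0%N * g 0%N.
Proof. by rewrite fpsM big_ord1. Qed.

Lemma coef_trunc_mul n k f g : (k < n)%N -> (f * g) k = (trunc n f * trunc n g)`_k.
Proof. exact: fps_mul_trunc. Qed.

Definition mono (c : int) (k : nat) : fps := fun n => if n == k then c else 0.

Lemma mono10 : mono 1 0 = 1.
Proof. by apply: fpsP => n; rewrite /mono fps1; case: eqP. Qed.

Lemma monoME c k f n :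
  (mono c k * f) n = if (k <= n)%N then c * f (n - k)%N else 0.
Proof.
rewrite fpsM; case: leqP => [le_kn|lt_nk].
  have lt_kn : (k < n.+1)%N by [].
  rewrite (bigD1 (Ordinal lt_kn)) //= big1 ?addr0 /mono ?eqxx // => i.
  by rewrite -val_eqE /= => /negPf->; rewrite mul0r.
rewrite big1 // => i _; rewrite /mono ltn_eqF ?mul0r //.
by rewrite (leq_trans (ltn_ord i)).
Qed.

Lemma monoM a k b l : mono a k * mono b l = mono (a * b) (k + l).
Proof.
apply: fpsP => n; rewrite monoME /mono; case: leqP => [le_kn|lt_nk].
  by rewrite -(eqn_add2l k) subnKC //; case: eqP; rewrite ?mulr0.
by rewrite ltn_eqF // (leq_trans lt_nk) // leq_addr.
Qed.

Lemma monoN c k : mono (- c) k = - mono c k.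
Proof. by apply: fpsP => n; rewrite fpsN /mono; case: eqP; rewrite ?oppr0. Qed.

Lemma monoX c k n : mono c k ^+ n = mono (c ^+ n) (n * k).
Proof.
by elim: n => [|n IH]; rewrite ?expr0 ?mono10 // !exprS IH monoM mulSn.
Qed.

Lemma mono_lreg c k : c != 0 -> injective ( *%R (mono c k)).
Proof.
move=> c_neq0 f g eq_fg; apply: fpsP => n.
have /(congr1 (@^~ (n + k)%N)) := eq_fg.
by rewrite !monoME leq_addl addnK => /(mulfI c_neq0).
Qed.

Definition eqf n f g := forall k, (k <= n)%N -> f k = g k.

Lemma eqf_refl n f : eqf n f f. Proof. by []. Qed.

Lemma eqf_sym n f g : eqf n f g -> eqf n g f.
Proof. by move=> fg k /fg. Qed.

Lemma eqf_trans n f g h : eqf n f g -> eqf n g h -> eqf n f h.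
Proof. by move=> fg gh k le_kn; rewrite fg ?gh. Qed.

Lemma eqfP f g : (forall n, eqf n f g) -> f = g.
Proof. by move=> fg; apply: fpsP => n; apply: (fg n). Qed.

Lemma eqfD n f g f' g' : eqf n f f' -> eqf n g g' -> eqf n (f + g) (f' + g').
Proof. by move=> ff' gg' k le_kn; rewrite !fpsD ff' ?gg'. Qed.

Lemma eqfM n f g f' g' : eqf n f f' -> eqf n g g' -> eqf n (f * g) (f' * g').
Proof.
move=> ff' gg' k le_kn; rewrite !fpsM; apply: eq_bigr => i _.
rewrite ff' ?gg' ?(leq_trans (leq_subr _ _)) //.
by rewrite (leq_trans _ le_kn) // -ltnS.
Qed.

Lemma eqf_sums n (I : eqType) (s : seq I) (F G : I -> fps) :
  (forall i, i \in s -> eqf n (F i) (G i)) ->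
  eqf n (\sum_(i <- s) F i) (\sum_(i <- s) G i).
Proof.
move=> FG; rewrite big_seq [X in eqf _ _ X]big_seq.
by apply: (big_ind2 (eqf n)) => // f g f' g'; apply: eqfD.
Qed.

Lemma eqf_mono0 n c k : (n < k)%N -> eqf n (mono c k) 0.
Proof.
by move=> lt_nk l le_ln; rewrite /mono ltn_eqF // (leq_ltn_trans le_ln).
Qed.

(** Strong induction on the degree: once all lower coefficients agree, coefficient n of the product
    determines that of the factor. Product identities below are proved by multiplying up and
    cancelling with this. *)
Lemma lreg1 f : f 0%N = 1 -> injective ( *%R f).
Proof.
move=> f0 g h eq_fgh; apply: fpsP => n; elim/ltn_ind: n => n IH.
have := congr1 (@^~ n) eq_fgh; rewrite /= !fpsM !big_ord_recl f0 !mul1r !subn0.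
rewrite (eq_bigr (fun i : 'I_n => f (lift ord0 i) * h (n - lift ord0 i)%N)).
  by move=> /addIr.
by move=> [i lt_in] _; rewrite IH //= /bump /= add1n; lia.
Qed.

(* The geometric series \sum_k (1 - f)^k, truncated degree by degree. *)
Lemma inv1 f : f 0%N = 1 -> exists g, f * g = 1.
Proof.
move=> f0; exists (fun n => (\sum_(k < n.+1) (1 - f) ^+ k) n).
have small k n h : (n < k)%N -> (h * (1 - f) ^+ k) n = 0.
  have u0 : (1 - f) 0%N = 0 by rewrite fpsD fpsN f0 fps1.
  elim: k n h => [//|k IH] n h; rewrite ltnS => le_nk.
  rewrite exprS mulrA mulrAC fpsM big1 // => i _.
  have [lt_ik|] := ltnP i k; first by rewrite IH ?mul0r.
  move=> le_ki; have := ltn_ord i; rewrite ltnS => le_in.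
  have -> : (n - i = 0)%N by lia.
  by rewrite u0 mulr0.
have stab m n : (m <= n)%N ->
    (\sum_(k < n.+1) (1 - f) ^+ k) m = (\sum_(k < m.+1) (1 - f) ^+ k) m.
  elim: n => [|n IH]; first by rewrite leqn0 => /eqP->.
  rewrite leq_eqVlt => /predU1P[-> //|]; rewrite ltnS => le_mn.
  rewrite [in LHS]big_ord_recr /= fpsD IH // -[(1 - f) ^+ _]mul1r.
  by rewrite small ?addr0 // ltnS.
apply: fpsP => n; transitivity ((f * \sum_(k < n.+1) (1 - f) ^+ k) n).
  by apply: (eqfM (n := n)) => // k le_kn; rewrite stab.
have {1}-> : f = - (1 - f - 1) by ring.
rewrite mulNr -subrX1 opprB fpsD fpsN -[(1 - f) ^+ _]mul1r small ?subr0 //.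
Qed.

End Ring.

(** * Dilations and sections *)

Section Sections.
Implicit Types f g : fps.

Definition dil (m : nat) f : fps := fun n => if (m %| n)%N then f (n %/ m)%N else 0.

Definition sect (m r : nat) f : fps := fun n => f (m * n + r)%N.

(** Substituting q^m for q is polynomial composition on truncations. At [m = 0] only the constant
    term survives, which is multiplicative too, so [dil m] is a ring morphism for every [m]. *)
Lemma dilM m f g : dil m (f * g) = dil m f * dil m g.
Proof.
apply: fpsP => n; case: (posnP m) => [->|m_gt0].
  rewrite /dil dvd0n; case: eqP => [->|n0]; first by rewrite !fpsM0 /= div0n.
  rewrite fpsM big1 // => i _; rewrite !dvd0n.
  case: eqP => [i0|_]; last by rewrite mul0r.
  by rewrite i0 subn0; case: eqP; rewrite ?mulr0.
have truncV h : forall k, (k < n.+1)%N ->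
    (trunc n.+1 h \Po 'X^m)`_k = (trunc n.+1 (dil m h))`_k.
  move=> k lt_kn; rewrite coef_comp_poly_Xn // [RHS]coef_trunc // /dil.
  by case: ifP => // _; rewrite coef_trunc // (leq_ltn_trans (leq_div _ _)).
rewrite [RHS](@coef_trunc_mul n.+1) //.
rewrite -(coefM_agree (p := trunc n.+1 f \Po 'X^m) (r := trunc n.+1 g \Po 'X^m))
  => [| k le_kn | k le_kn]; try exact: truncV.
rewrite -comp_polyM coef_comp_poly_Xn // /dil; case: ifP => // _.
by rewrite (@coef_trunc_mul n.+1) // ltnS leq_div.
Qed.

Lemma dil1 m : dil m 1 = 1.
Proof.
apply: fpsP => n; rewrite /dil !fps1; case: (posnP n) => [->|n_gt0].
  by rewrite dvdn0 div0n.
case: ifP => // /dvdnP[k def_n].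
case: (posnP m) def_n => [->|m_gt0] def_n; first by rewrite def_n muln0 in n_gt0.
by rewrite {1}def_n mulnK //; case: k def_n n_gt0 => // ->.
Qed.

Fact dil_is_zmod m : zmod_morphism (dil m).
Proof.
move=> f g; apply: fpsP => n; rewrite !fpsD !fpsN /dil.
by case: ifP => // _; rewrite subrr.
Qed.
Fact dil_is_monoid m : monoid_morphism (dil m).
Proof. by split; [apply: dil1 | apply: dilM]. Qed.
HB.instance Definition _ m :=
  GRing.isZmodMorphism.Build fps fps (dil m) (dil_is_zmod m).
HB.instance Definition _ m :=
  GRing.isMonoidMorphism.Build fps fps (dil m) (dil_is_monoid m).

Lemma dil_mono m c k : (0 < m)%N -> dil m (mono c k) = mono c (m * k).
Proof.
move=> m_gt0; apply: fpsP => n; rewrite /dil /mono; case: (boolP (m %| n)%N) => [/dvdnP[j ->]|ndiv].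
  by rewrite mulnK // mulnC eqn_pmul2l.
by case: eqP => // n_mk; rewrite n_mk dvdn_mulr in ndiv.
Qed.

Lemma dil_dil a b f : (0 < a)%N -> dil a (dil b f) = dil (a * b) f.
Proof.
move=> a_gt0; apply: fpsP => n; rewrite /dil.
case: (boolP (a %| n)%N) => [/dvdnP[k ->]|nan].
  by rewrite mulnK // [(k * a)%N]mulnC dvdn_pmul2l // divnMl.
by rewrite ifN //; apply: contra nan => /(dvdn_trans (dvdn_mulr _ (dvdnn _))).
Qed.

Lemma dil00 m f : dil m f 0%N = f 0%N.
Proof. by rewrite /dil dvdn0 div0n. Qed.

Fact sect_is_zmod m r : zmod_morphism (sect m r).
Proof. by []. Qed.
HB.instance Definition _ m r :=
  GRing.isZmodMorphism.Build fps fps (sect m r) (sect_is_zmod m r).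

Lemma sect_mono m r s l f : (r < m)%N -> (s < m)%N ->
  sect m r (mono 1 (m * l + s) * dil m f) = if s == r then mono 1 l * f else 0.
Proof.
move=> lt_rm lt_sm; have m_gt0 : (0 < m)%N by case: m lt_rm {lt_sm}.
apply: fpsP => n; rewrite /sect monoME /dil mul1r.
case: eqP => [->|neq].
  rewrite leq_add2r leq_pmul2l // monoME mul1r subnDr -mulnBr.
  by rewrite dvdn_mulr // mulKn.
rewrite fps0; case: leqP => // le_ln; case: ifP => // /dvdnP[k def_k]; case: neq.
have := congr1 (modn^~ m) (subnK le_ln).
by rewrite def_k mulnC addnA -mulnDr ![(m * _)%N]mulnC !modnMDl !modn_small.
Qed.

Lemma sect_dil m r f : (0 < r < m)%N -> sect m r (dil m f) = 0.
Proof.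
case/andP => r_gt0 lt_rm; have := sect_mono 0 f lt_rm (ltn_trans r_gt0 lt_rm).
by rewrite muln0 mono10 mul1r ltn_eqF.
Qed.

Lemma sect0_dil m f : (0 < m)%N -> sect m 0 (dil m f) = f.
Proof.
by move=> m_gt0; have := sect_mono 0 f m_gt0 m_gt0; rewrite muln0 mono10 !mul1r.
Qed.

Lemma dissection m f : (0 < m)%N ->
  f = \sum_(s < m) mono 1 s * dil m (sect m s f).
Proof.
move=> m_gt0; apply: fpsP => n; rewrite fps_sum.
rewrite (bigD1 (Ordinal (ltn_pmod n m_gt0))) //= big1 ?addr0.
  rewrite monoME leq_mod mul1r.
  have -> : (n - n %% m = n %/ m * m)%N by rewrite {1}(divn_eq n m) addnK.
  rewrite /dil dvdn_mull // mulnK //.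
  by rewrite /sect mulnC -divn_eq.
move=> [s lt_sm]; rewrite -val_eqE /= => neq; rewrite monoME; case: leqP => // le_sn.
rewrite mul1r /dil ifN //; apply: contra neq => /dvdnP[k def_k].
by rewrite -(subnK le_sn) def_k modnMDl modn_small.
Qed.

(** Series in q^m are scalars for sections modulo m; this is why denominators are first brought to
    the form [dil m _]. *)
Lemma sectM m r f g : (r < m)%N -> sect m r (f * dil m g) = sect m r f * g.
Proof.
move=> lt_rm; have m_gt0 : (0 < m)%N by case: m lt_rm.
rewrite {1}(dissection f m_gt0) mulr_suml raddf_sum (bigD1 (Ordinal lt_rm)) //=.
rewrite big1 => [|s]; last first.
  rewrite -val_eqE /= => neq; rewrite -mulrA -dilM.
  by have := sect_mono 0 (sect m s f * g) lt_rm (ltn_ord s); rewrite muln0 (negPf neq).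
have := sect_mono 0 (sect m r f * g) lt_rm lt_rm.
by rewrite muln0 eqxx mono10 mul1r addr0 -mulrA -dilM.
Qed.

Lemma sect_sect a b r s f : sect a r (sect b s f) = sect (b * a) (b * r + s) f.
Proof. by apply: fpsP => n; rewrite /sect mulnDr addnA mulnA. Qed.

End Sections.

(** * Infinite products *)

Definition tends (u : nat -> fps) (f : fps) :=
  forall n, exists N, forall k, (N <= k)%N -> eqf n (u k) f.

Lemma tends_uniq u f g : tends u f -> tends u g -> f = g.
Proof.
move=> uf ug; apply: eqfP => n; have [N Nf] := uf n; have [M Mg] := ug n.
exact: eqf_trans (eqf_sym (Nf _ (leq_maxl N M))) (Mg _ (leq_maxr N M)).
Qed.

Lemma tendsM u v f g : tends u f -> tends v g -> tends (fun k => u k * v k) (f * g).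
Proof.
move=> uf vg n; have [N Nf] := uf n; have [M Mg] := vg n.
by exists (maxn N M) => k; rewrite geq_max => /andP[Nk Mk]; apply: eqfM; auto.
Qed.

Lemma tends_cst f : tends (fun=> f) f.
Proof. by move=> n; exists 0%N. Qed.

Lemma tends_prod (I : Type) (s : seq I) (u : I -> nat -> fps) (f : I -> fps) :
  (forall i, tends (u i) (f i)) ->
  tends (fun k => \prod_(i <- s) u i k) (\prod_(i <- s) f i).
Proof.
move=> uf; elim: s => [|i s IH] n.
  by exists 0%N => k _; rewrite !big_nil.
have [N Ns] := tendsM (uf i) IH n; exists N => k Nk.
by rewrite !big_cons; apply: Ns.
Qed.

Lemma tends_sub u f (phi : nat -> nat) : (forall k, (k <= phi k)%N) ->
  tends u f -> tends (fun k => u (phi k)) f.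
Proof.
move=> phi_ge uf n; have [N Nf] := uf n.
by exists N => k Nk; apply/Nf/(leq_trans Nk).
Qed.

Lemma tends_dil m u f : tends u f -> tends (fun k => dil m (u k)) (dil m f).
Proof.
move=> uf n; have [N Nf] := uf n; exists N => k Nk l le_ln; rewrite /dil.
by case: ifP => // _; apply: (Nf k Nk); apply: leq_trans (leq_div _ _) le_ln.
Qed.

Lemma tends_ext u v f : u =1 v -> tends u f -> tends v f.
Proof.
by move=> uv uf n; have [N Nf] := uf n; exists N => k Nk; rewrite -uv; apply: Nf.
Qed.

Definition pprod (c : int) (i m N : nat) : fps :=
  \prod_(k < N) (1 + mono c (i + m * k)).

(* \prod_k (1 + c q^(i + m k)), meaningful for m > 0. *)
Definition pr (c : int) (i m : nat) : fps := fun n => pprod c i m n.+1 n.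

Lemma pprodS c i m N :
  pprod c i m N.+1 = pprod c i m N * (1 + mono c (i + m * N)).
Proof. by rewrite /pprod big_ord_recr. Qed.

Lemma pprod_stable c i m n N : (0 < m)%N -> (n < N)%N ->
  eqf n (pprod c i m N) (pprod c i m n.+1).
Proof.
move=> m_gt0; elim: N => // N IH; rewrite ltnS leq_eqVlt => /predU1P[-> //|lt_nN].
rewrite pprodS; apply: eqf_trans (IH lt_nN).
rewrite -[X in eqf _ _ X]mulr1; apply: eqfM => //.
rewrite -[X in eqf _ _ X](addr0 1); apply: eqfD => //; apply: eqf_mono0.
by rewrite ltn_addl // (leq_trans lt_nN) // leq_pmull.
Qed.

Lemma pprod_pr c i m n N : (0 < m)%N -> (n < N)%N ->
  eqf n (pprod c i m N) (pr c i m).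
Proof.
move=> m_gt0 lt_nN k le_kn; apply: (pprod_stable c i m_gt0) => //.
exact: leq_ltn_trans lt_nN.
Qed.

Lemma tends_pprod c i m : (0 < m)%N -> tends (pprod c i m) (pr c i m).
Proof. by move=> m_gt0 n; exists n.+1 => k; apply: pprod_pr. Qed.

Lemma pr00 c i m : (0 < i)%N -> pr c i m 0%N = 1.
Proof.
by case: i => // i _; rewrite /pr /pprod big_ord1 fpsD fps1 /mono muln0 addr0.
Qed.

(** Sort the factors by their index modulo p; the partial products agree exactly at p N factors. *)
Lemma pr_split p c i m : (0 < p)%N -> (0 < m)%N ->
  pr c i m = \prod_(r < p) pr c (i + m * r) (p * m).
Proof.
move=> p_gt0 m_gt0.
have pm_gt0 : (0 < p * m)%N by rewrite muln_gt0 p_gt0.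
apply: (tends_uniq (u := fun N => pprod c i m (p * N))).
  by apply: tends_sub (tends_pprod c i m_gt0) => k; rewrite leq_pmull.
apply: (tends_ext (u := fun N => \prod_(r < p) pprod c (i + m * r) (p * m) N)).
  elim=> [|N IH]; first by rewrite muln0 [RHS]big_ord0 big1 // => r _; apply: big_ord0.
  under eq_bigr do rewrite pprodS.
  rewrite big_split /= IH mulnS addnC /pprod big_split_ord /=; congr (_ * _).
  apply: eq_bigr => r _; congr (1 + mono _ _).
  by rewrite mulnDr; lia.
by apply: tends_prod => r; apply: tends_pprod.
Qed.

Lemma pr_split2 c i m : (0 < m)%N ->
  pr c i m = pr c i (2 * m) * pr c (i + m) (2 * m).
Proof. by move=> m0; rewrite (pr_split (p := 2)) // !big_ord_recl big_ord0 muln0 muln1 addn0 mulr1. Qed.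

Lemma pr_split3 c i m : (0 < m)%N ->
  pr c i m = pr c i (3 * m) * pr c (i + m) (3 * m) * pr c (i + m * 2) (3 * m).
Proof.
by move=> m0; rewrite (pr_split (p := 3)) // !big_ord_recl big_ord0 muln0 muln1 addn0 mulr1 mulrA.
Qed.

(** Factor by factor, (1 + x)(1 - x) = 1 - x^2. *)
Lemma pr_conj i m : (0 < m)%N ->
  pr 1 i m * pr (-1) i m = pr (-1) (2 * i) (2 * m).
Proof.
move=> m_gt0.
apply: (tends_uniq (u := fun N => pprod 1 i m N * pprod (-1) i m N)).
  by apply: tendsM; apply: tends_pprod.
apply: tends_ext (tends_pprod _ _ _); last by rewrite muln_gt0.
move=> N; rewrite /pprod -big_split; apply: eq_bigr => k _ /=.
have -> : (2 * i + 2 * m * k = (i + m * k) + (i + m * k))%N by lia.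
have -> : mono (-1) (i + m * k + (i + m * k)) = - (mono 1 (i + m * k) * mono 1 (i + m * k)).
  by rewrite monoM mul1r monoN.
by rewrite monoN; ring.
Qed.

Lemma dil_pr d c i m : (0 < d)%N -> (0 < m)%N ->
  dil d (pr c i m) = pr c (d * i) (d * m).
Proof.
move=> d_gt0 m_gt0; apply: (tends_uniq (u := fun N => dil d (pprod c i m N))).
  by apply: tends_dil; apply: tends_pprod.
apply: tends_ext (tends_pprod _ _ _); last by rewrite muln_gt0 d_gt0.
move=> N; rewrite /pprod rmorph_prod; apply: eq_bigr => k _ /=.
by rewrite rmorphD rmorph1 /= dil_mono // mulnDr mulnA.
Qed.

(** * Unconditional sums *)

Section HasSum.
Variable I : choiceType.
Implicit Types (F : I -> fps) (f : fps) (s : seq I).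

(** Summability in the q-adic topology: up to degree n only finitely many terms count. No order on
    [I] is involved, so sums can be reindexed by bijections. *)
Definition hasSum F f := forall n, exists s, [/\ uniq s,
  eqf n (\sum_(i <- s) F i) f & forall i, i \notin s -> eqf n (F i) 0].

Lemma eqf_sum_filter n F s (P : pred I) :
  (forall i, i \in s -> ~~ P i -> eqf n (F i) 0) ->
  eqf n (\sum_(i <- s) F i) (\sum_(i <- s | P i) F i).
Proof.
move=> F0; rewrite (bigID P) /= -[X in eqf _ _ X]addr0; apply: eqfD => //.
rewrite big_seq_cond; apply: (big_ind (fun f => eqf n f 0)) => // [f g f0 g0|i].
  by rewrite -[0]addr0; apply: eqfD.
by case/andP; apply: F0.
Qed.

(** Two finite supports valid up to degree n give the same sum, namely that over their
    intersection. *)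
Lemma hasSum_eqf n F f s : hasSum F f -> uniq s ->
  (forall i, i \notin s -> eqf n (F i) 0) -> eqf n (\sum_(i <- s) F i) f.
Proof.
move=> Ff Us s0; have [t [Ut tf t0]] := Ff n.
apply: eqf_trans (eqf_trans (eqf_sum_filter (P := mem t) _) _) tf => [i _|]; first exact: t0.
apply: eqf_trans (eqf_sym (eqf_sum_filter (P := mem s) _)) => [|i _]; last exact: s0.
rewrite -big_filter -[X in eqf _ _ X]big_filter.
rewrite [X in eqf _ _ X](perm_big [seq i <- s | i \in t]) //.
apply: uniq_perm; rewrite ?filter_uniq // => i.
by rewrite !mem_filter andbC.
Qed.

Lemma hasSum_uniq F f g : hasSum F f -> hasSum F g -> f = g.
Proof.
move=> Ff Fg; apply: eqfP => n; have [s [Us sf s0]] := Ff n.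
exact: eqf_trans (eqf_sym sf) (hasSum_eqf Fg Us s0).
Qed.

Lemma hasSum_ext F G f : F =1 G -> hasSum F f -> hasSum G f.
Proof.
move=> FG Ff n; have [s [Us sf s0]] := Ff n; exists s; split=> // [|i si].
  by under eq_bigr do rewrite -FG.
by rewrite -FG; apply: s0.
Qed.

Lemma hasSumMl g F f : hasSum F f -> hasSum (fun i => g * F i) (g * f).
Proof.
move=> Ff n; have [s [Us sf s0]] := Ff n; exists s; split=> // [|i si].
  by rewrite -mulr_sumr; apply: eqfM.
by rewrite -(mulr0 g); apply: eqfM => //; apply: s0.
Qed.

Lemma hasSum_dil m F f : hasSum F f -> hasSum (fun i => dil m (F i)) (dil m f).
Proof.
have dil_eqf n g h : eqf n g h -> eqf n (dil m g) (dil m h).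
  move=> gh l le_ln; rewrite /dil; case: ifP => // _.
  by apply: gh; apply: leq_trans (leq_div _ _) le_ln.
move=> Ff n; have [s [Us sf s0]] := Ff n; exists s; split=> // [|i si].
  by rewrite -rmorph_sum /=; apply: dil_eqf.
by rewrite -(rmorph0 (dil m)); apply/dil_eqf/s0.
Qed.

End HasSum.

Lemma hasSum_bij (I J : choiceType) (h : J -> I) F f :
  bijective h -> hasSum F f -> hasSum (F \o h) f.
Proof.
move=> [k hK kK] Ff n; have [s [Us sf s0]] := Ff n; exists (map k s); split.
- by rewrite map_inj_uniq //; apply: can_inj kK.
- by rewrite big_map /=; under eq_bigr do rewrite kK.
- by move=> j js; apply: s0; apply: contra js => js; rewrite -[j]hK map_f.
Qed.

Lemma hasSum_mul (I J : choiceType) F G f g :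
  hasSum F f -> hasSum G g ->
  hasSum (fun p : I * J => F p.1 * G p.2) (f * g).
Proof.
move=> Ff Gg n; have [s [Us sf s0]] := Ff n; have [t [Ut tg t0]] := Gg n.
exists [seq (i, j) | i <- s, j <- t]; split.
- by rewrite allpairs_uniq // => -[? ?] [? ?].
- by rewrite big_allpairs /=; under eq_bigr do rewrite -mulr_sumr;
    rewrite -mulr_suml; apply: eqfM.
- move=> [i j]; rewrite -[_ \in _]/((i, j) \in _).
  have -> : ((i, j) \in [seq (i, j) | i <- s, j <- t]) = (i \in s) && (j \in t).
    apply/allpairsP/andP => [[[i' j'] [/= ? ? [-> ->]]]|[? ?]] //.
    by exists (i, j).
  rewrite negb_and => /orP[/s0 F0|/t0 G0] /=.
    by rewrite -(mul0r (G j)); apply: eqfM.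
  by rewrite -(mulr0 (F i)); apply: eqfM.
Qed.

Lemma hasSum_pair (K : finType) (J : choiceType) (F : K * J -> fps) (f : K -> fps) :
  (forall k, hasSum (fun j => F (k, j)) (f k)) -> hasSum F (\sum_k f k).
Proof.
move=> Ff n; have [S HS] := choice (fun k => Ff k n).
exists [seq (k, j) | k <- enum K, j <- S k]; split.
- apply: allpairs_uniq_dep => [|k _|]; first exact: enum_uniq.
    by case: (HS k).
  by move=> [k j] [k' j'] _ _ /= [-> ->].
- rewrite big_allpairs_dep /= -[\sum_k f k]big_enum /=.
  by apply: eqf_sums => k _; case: (HS k).
- move=> [k j] kj; case: (HS k) => _ _ S0; apply: S0.
  by apply: contra kj => js; apply: allpairs_f_dep; rewrite ?mem_enum.
Qed.

Lemma hasSum_split (K : finType) (I J : choiceType) (h : K -> J -> I) F f (g : K -> fps) :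
  bijective (fun p : K * J => h p.1 p.2) ->
  (forall k, hasSum (F \o h k) (g k)) -> hasSum F f -> f = \sum_k g k.
Proof.
move=> h_bij Fg Ff; apply: hasSum_uniq (hasSum_bij h_bij Ff) _.
exact: hasSum_pair.
Qed.

(** * Gaussian binomials and the triple product *)

Section QBinomial.
Variables (R : comNzRingType) (q : R).

(** The Gaussian binomial by its Pascal rule. When [m'] exceeds [n'] the truncated exponent is
    multiplied by zero ([qbin_small]). *)
Fixpoint qbin (n m : nat) : R :=
  match n, m with
  | _, 0 => 1
  | 0, _.+1 => 0
  | n'.+1, m'.+1 => qbin n' m'.+1 + q ^+ (n' - m') * qbin n' m'
  end.

Definition qfact (n : nat) : R := \prod_(k < n) (1 - q ^+ k.+1).

Lemma qfactS n : qfact n.+1 = qfact n * (1 - q ^+ n.+1).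
Proof. by rewrite /qfact big_ord_recr. Qed.

Lemma qbin0 n : qbin n 0 = 1.
Proof. by case: n. Qed.

Lemma qbinS n m : qbin n.+1 m.+1 = qbin n m.+1 + q ^+ (n - m) * qbin n m.
Proof. by []. Qed.

Lemma qbin_small n m : (n < m)%N -> qbin n m = 0.
Proof.
elim: n m => [|n IH] [|m] // lt_nm.
by rewrite qbinS !IH ?mulr0 ?addr0 // ltnW.
Qed.

(** The quotient formula for Gaussian binomials, without division. The inductive step is (1 -
    q^(l+1)) + q^(l+1) (1 - q^(m+1)) = 1 - q^(l+m+2). *)
Lemma qbin_fact m l : qbin (m + l) m * (qfact m * qfact l) = qfact (m + l).
Proof.
have [n] := ubnP (m + l); elim: n m l => // n IH [|m] l.
  by rewrite qbin0 add0n /qfact big_ord0 !mul1r.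
rewrite addSn ltnS => lt_n; rewrite qbinS !qfactS.
case: l lt_n => [|l] lt_n.
  have := IH m 0%N lt_n; rewrite !addn0 (@qbin_small m m.+1) // add0r subnn => E.
  transitivity (qbin m m * (qfact m * qfact 0) * (1 - q ^+ m.+1)); last by rewrite E.
  by rewrite expr0; ring.
rewrite addKn; have IH1 := IH m.+1 l; have IH2 := IH m l.+1 lt_n.
rewrite addSnnS in IH1; have {}IH1 := IH1 lt_n.
transitivity (qbin (m + l.+1) m.+1 * (qfact m.+1 * qfact l) * (1 - q ^+ l.+1) +
    q ^+ l.+1 * (qbin (m + l.+1) m * (qfact m * qfact l.+1)) * (1 - q ^+ m.+1)).
  by rewrite !qfactS; ring.
have -> : ((m + l.+1).+1 = l.+1 + m.+1)%N by lia.
by rewrite IH1 IH2 exprD; ring.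
Qed.

(** Homogeneous in [a] and [b], so that the negative powers of q in the triple product can be
    avoided by taking [a] to be a high monomial. *)
Lemma qbinomial (a b : R) n :
  \prod_(k < n) (a + b * q ^+ k) =
  \sum_(m < n.+1) qbin n m * (a ^+ (n - m) * b ^+ m * q ^+ 'C(m, 2)).
Proof.
elim: n => [|n IH].
  by rewrite big_ord0 big_ord1 /= subn0 bin0n !expr0 !mulr1.
rewrite big_ord_recr IH /= [RHS]big_ord_recl /= subn0 bin0n !expr0 !mulr1 mul1r.
rewrite [X in _ = _ + X](eq_bigr (fun m : 'I_n.+1 =>
   qbin n m.+1 * (a ^+ (n - m) * b ^+ m.+1 * q ^+ 'C(m.+1, 2)) +
   b * q ^+ n * (qbin n m * (a ^+ (n - m) * b ^+ m * q ^+ 'C(m, 2))))); last first.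
  move=> [m /= lt_mn] _; rewrite /bump /= add1n add0n subSS mulrDl; congr (_ + _).
  rewrite binS bin1 exprD -[in q ^+ n](subnK (m := m) (n := n)) // exprD exprS.
  by ring.
rewrite big_split /= -mulr_sumr addrA [LHS]mulrDr [in RHS]addrC.
rewrite [_ * (b * _)]mulrC addrC; congr (_ + _).
rewrite [in LHS]big_ord_recl [in RHS]big_ord_recr /= (@qbin_small n n.+1) // mul0r addr0.
rewrite qbin0 subn0 bin0n !expr0 !mulr1 mul1r mulrDl exprSr; congr (_ + _).
rewrite mulr_suml; apply: eq_bigr => [[m lt_mn]] _ /=.
rewrite /bump /= add1n; have -> : (n - m = (n - m.+1).+1)%N by lia.
by rewrite [a ^+ _.+1]exprS; ring.
Qed.

End QBinomial.

(** * Theta functions as sums over the integers *)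

Section Theta.

(* n (n + 1) / 2 *)
Definition tri (n : int) : nat :=
  match n with Posz k => 'C(k.+1, 2) | Negz k => 'C(k.+1, 2) end.

Lemma triE n : (2 * tri n)%:Z = n * (n + 1).
Proof.
have E k : (2 * 'C(k.+1, 2) = k.+1 * k)%N by rewrite -mul_bin_diag /= bin1.
by case: n => k; rewrite /tri E PoszM; lia.
Qed.

(** The right side is n^2. It makes the terms of index beyond n invisible in degree n. *)
Lemma tri_bound n : (`|n| <= tri n + tri (- n))%N.
Proof. by have := triE n; have := triE (- n); nia. Qed.

(* The terms of the theta function f(c q^i, c q^j) in Ramanujan's notation. *)
Definition tterm (c : int) (i j : nat) (n : int) : fps :=
  mono (c ^ n) (i * tri n + j * tri (- n)).

Definition zint (N : nat) : seq int := [seq m%:Z - N%:Z | m <- iota 0 (N + N).+1].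

Lemma zint_uniq N : uniq (zint N).
Proof. by rewrite map_inj_uniq ?iota_uniq // => x y; lia. Qed.

Lemma mem_zint N n : (n \in zint N) = (`|n| <= N)%N.
Proof.
apply/mapP/idP => [[m]|le_nN]; first by rewrite mem_iota => ? ->; lia.
by exists `|(n + N%:Z)%R|%N; rewrite ?mem_iota; lia.
Qed.

Variables (c : int) (i j : nat).
Hypotheses (i_gt0 : (0 < i)%N) (j_gt0 : (0 < j)%N).

Definition theta : fps := fun n => (\sum_(k <- zint n) tterm c i j k) n.

Lemma tterm_small n k : (n < `|k|)%N -> eqf n (tterm c i j k) 0.
Proof.
move=> lt_nk; apply: eqf_mono0; apply: leq_trans lt_nk _.
by apply: leq_trans (tri_bound k) _; rewrite leq_add // leq_pmull.
Qed.

Lemma hasSum_theta : hasSum (tterm c i j) theta.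
Proof.
move=> n; exists (zint n); split=> [||k]; first exact: zint_uniq; last first.
  by rewrite mem_zint -ltnNge; apply: tterm_small.
move=> l le_ln; rewrite /theta.
apply: (eqf_trans (eqf_sum_filter (P := fun k => `|k| <= l)%N _) _ (leqnn l)).
  by move=> k _; rewrite -ltnNge; apply: tterm_small.
rewrite -big_filter (perm_big (zint l)) //.
apply: uniq_perm; rewrite ?filter_uniq ?zint_uniq // => k.
by rewrite mem_filter !mem_zint; lia.
Qed.

End Theta.

Lemma qfactE m n : qfact (mono 1 m) n = pprod (-1) m m n.
Proof.
apply: eq_bigr => k _.
by rewrite monoX expr1n monoN -mulnS mulnC.
Qed.

(* Gauss's proof: the q-binomial theorem gives a finite version of the identity, *)
(* in which qbin (2N) (N + k) tends to 1 / (q)_oo for every fixed k.              *)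
Section TripleProduct.
Variables (c : int) (i j : nat).
Hypotheses (cc : c * c = 1) (i_gt0 : (0 < i)%N) (j_gt0 : (0 < j)%N).
Let m := (i + j)%N.
Let q := mono 1 m.

Let c_unit : c \is a GRing.unit.
Proof. by apply/unitrP; exists c. Qed.

Let c_neq0 : c != 0.
Proof. by apply/eqP => c0; move: cc; rewrite c0. Qed.

(** The first K+1 factors, read backwards, give the progression from j after a power of q and a sign
    c are taken out (using c^2 = 1); the remaining ones give the progression from i. *)
Lemma finite_product K :
  \prod_(k < K.+1 + K.+1) (mono 1 (j + m * K) + mono c 0 * q ^+ k) =
  mono (c ^+ K.+1) (m * 'C(K.+1, 2) + K.+1 * (j + m * K)) *
    (pprod c j m K.+1 * pprod c i m K.+1).
Proof.
have prod_mono (a : int) n (e : nat -> nat) :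
    \prod_(k < n) mono a (e k) = mono (a ^+ n) (\sum_(k < n) e k).
  elim: n => [|n IH]; first by rewrite !big_ord0 mono10.
  by rewrite !big_ord_recr /= IH monoM exprSr.
rewrite big_split_ord /=.
rewrite (reindex_inj rev_ord_inj) /=.
rewrite (eq_bigr (fun l : 'I_K.+1 =>
  mono c (m * (K - l)) * (1 + mono c (j + m * l)))); last first.
  move=> [l lt_l] _ /=; rewrite monoX expr1n monoM mulr1 add0n mulrDr mulr1 monoM cc.
  rewrite subSS addrC [((K - l) * m)%N]mulnC; congr (_ + mono _ _).
  by rewrite addnCA -mulnDr subnK.
rewrite [X in _ * X](eq_bigr (fun l : 'I_K.+1 =>
  mono 1 (j + m * K) * (1 + mono c (i + m * l)))); last first.
  move=> l _; rewrite monoX expr1n monoM mulr1 add0n mulrDr mulr1 monoM mul1r.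
  by congr (_ + mono _ _); rewrite /m; ring.
rewrite !big_split /= (prod_mono c _ (fun l => m * (K - l))%N).
rewrite (prod_mono 1 _ (fun=> j + m * K)%N) expr1n sum_nat_const card_ord.
have -> : (\sum_(l < K.+1) m * (K - l) = m * 'C(K.+1, 2))%N.
  rewrite -bin2_sum big_mkord big_distrr (reindex_inj rev_ord_inj) /=.
  by apply: eq_bigr => l _; congr (_ * _)%N; rewrite subSS subKn // -ltnS.
have -> : mono (c ^+ K.+1) (m * 'C(K.+1, 2) + K.+1 * (j + m * K)) =
  mono (c ^+ K.+1) (m * 'C(K.+1, 2)) * mono 1 (K.+1 * (j + m * K)).
  by rewrite monoM mulr1.
by rewrite /pprod; ring.
Qed.

(** Expand [finite_product] by [qbinomial], recentre the summation index at K+1 and cancel the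
    common monomial. *)
Lemma finite_triple K :
  pprod c j m K.+1 * pprod c i m K.+1 =
  \sum_(l < (K.+1 + K.+1).+1) qbin q (K.+1 + K.+1) l * tterm c i j (l%:Z - K.+1%:Z).
Proof.
apply: (mono_lreg (c := c ^+ K.+1) (k := m * 'C(K.+1, 2) + K.+1 * (j + m * K))).
  exact: expf_neq0.
rewrite -finite_product qbinomial mulr_sumr; apply: eq_bigr => l' _.
have := ltn_ord l'; move: (nat_of_ord l') => l lt_l {l'}.
rewrite [RHS]mulrCA; congr (_ * _).
rewrite /q !monoX !expr1n /tterm !monoM ?mul1r ?mulr1.
set n := l%:Z - _; congr mono.
  by rewrite !exprnP -exprzDr // /n addrC subrK.
apply/eqP; rewrite -eqz_nat; apply/eqP.
have binE k : (2 * 'C(k, 2))%:Z = k%:Z * (k%:Z - 1).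
  case: k => // k; have -> : (2 * 'C(k.+1, 2) = k.+1 * k)%N.
    by rewrite -mul_bin_diag /= bin1.
  by lia.
(* Each quadratic identity is multiplied by its coefficient in the exponent, so that the goal
   becomes linear in the resulting monomials. *)
have El := congr1 ( *%R m%:Z) (binE l).
have EK := congr1 ( *%R m%:Z) (binE K.+1).
have Ei := congr1 ( *%R i%:Z) (triE n).
have Ej := congr1 ( *%R j%:Z) (triE (- n)).
rewrite /n in Ei Ej *; rewrite /m in El EK *.
have [r Er] : exists r, (r + l = K.+1 + K.+1)%N.
  by exists (K.+1 + K.+1 - l)%N; rewrite subnK.
have -> : (K.+1 + K.+1 - l = r)%N by lia.
have {}Er : r%:Z * (j%:Z + (i%:Z + j%:Z) * K%:Z) =
    (K%:Z + 1 + K%:Z + 1 - l%:Z) * (j%:Z + (i%:Z + j%:Z) * K%:Z).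
  by congr (_ * _); lia.
move: (tri _) (tri _) 'C(l, 2) 'C(K.+1, 2) Ei Ej El EK => t1 t2 b1 b2 Ei Ej El EK.
lia.
Qed.


Theorem triple_product :
  theta c i j = pr c i (i + j) * pr c j (i + j) * pr (-1) (i + j) (i + j).
Proof.
have m_gt0 : (0 < m)%N by rewrite addn_gt0 i_gt0.
(* With K = 2n, an index k at distance at most n from K+1 satisfies k > n and 2K+2-k > n, so all
   q-factorials involved agree with [P] up to degree n. *)
rewrite -/m; apply: eqfP => n; set K := (2 * n)%N; set P := pr (-1) m m.
have P0 : P 0%N = 1 by apply: pr00.
have [Y PY] := inv1 P0.
have qfactP k : (n < k)%N -> eqf n (qfact q k) P.
  by move=> lt_nk; rewrite qfactE; apply: pprod_pr.
apply: eqf_sym; apply: (@eqf_trans _ _ (P * (pprod c j m K.+1 * pprod c i m K.+1))).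
  have -> : pr c i m * pr c j m * P = P * (pr c j m * pr c i m) by ring.
  by apply: eqfM => //; apply: eqfM; apply: eqf_sym; apply: pprod_pr => //; lia.
apply: eqf_trans (hasSum_eqf (hasSum_theta c i_gt0 j_gt0) (zint_uniq K.+1) _); last first.
  by move=> k; rewrite mem_zint -ltnNge => lt_k; apply: tterm_small => //; lia.
rewrite finite_triple mulr_sumr /zint big_map.
rewrite -(big_mkord xpredT (fun l =>
  P * (qbin q (K.+1 + K.+1) l * tterm c i j (l%:Z - K.+1%:Z)))).
rewrite /index_iota subn0; apply: eqf_sums => k; rewrite mem_iota => lt_k.
have [small|large] := ltnP n `|k%:Z - K.+1%:Z|%N.
  have T0 := tterm_small c i_gt0 j_gt0 small.
  apply: eqf_trans (eqf_sym T0); rewrite -(mulr0 P) -(mulr0 (qbin q (K.+1 + K.+1) k)).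
  by apply: eqfM => //; apply: eqfM.
rewrite mulrA -[X in eqf _ _ X]mul1r; apply: eqfM => //.
have [l def_l] : exists l, (k + l = K.+1 + K.+1)%N.
  by exists (K.+1 + K.+1 - k)%N; rewrite subnKC.
have QE := qbin_fact q k l; rewrite def_l in QE.
(* Up to degree n, the binomial times P^2 equals P by [qbin_fact]; multiplying by the inverse [Y]
   leaves binomial times P equal to 1. *)
apply: (@eqf_trans _ _ (Y * (qbin q (K.+1 + K.+1) k * (qfact q k * qfact q l)))).
  have -> : P * qbin q (K.+1 + K.+1) k = Y * (qbin q (K.+1 + K.+1) k * (P * P)).
    by rewrite -[LHS]mul1r -PY; ring.
  by do 3?apply: eqfM => //; apply: eqf_sym; apply: qfactP; lia.
by rewrite QE -PY mulrC; apply: eqfM => //; apply: qfactP; lia.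
Qed.

End TripleProduct.

(** * Dissections of theta functions *)

Lemma dil_id f : dil 1 f = f.
Proof. by apply: fpsP => n; rewrite /dil dvd1n divn1. Qed.


Lemma hasSum_theta_affine (a : int) e d c i j (s : int -> int) F :
  (0 < i)%N -> (0 < j)%N -> bijective s ->
  (forall n, F n = mono a e * dil d (tterm c i j (s n))) ->
  hasSum F (mono a e * dil d (theta c i j)).
Proof.
move=> i0 j0 s_bij FE.
have H := hasSumMl (mono a e) (hasSum_dil d (hasSum_theta c i0 j0)).
by apply: hasSum_ext (hasSum_bij s_bij H) => n; rewrite /= FE.
Qed.

Lemma bij_shift (t : int) : bijective (fun n : int => n + t).
Proof. by exists (fun n => n - t) => n; rewrite ?addrK ?subrK. Qed.

Lemma bij_opp : bijective (fun n : int => - n).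
Proof. by exists (fun n => - n) => n; rewrite opprK. Qed.

Lemma residues_bij m : bijective (fun p : 'I_m.+1 * int => m.+1%:Z * p.2 + p.1%:Z).
Proof.
exists (fun n : int => (inord (absz (n %% m.+1)%Z), (n %/ m.+1)%Z)) => [[r n]|n] /=.
  rewrite mulrC divzMDl // modzMDl modz_small ?absz_nat ?divz_small //.
  - by rewrite addr0 inord_val.
  - by have := ltn_ord r; lia.
  - by have := ltn_ord r; lia.
rewrite inordK; first by rewrite gez0_abs ?modz_ge0 // mulrC -divz_eq.
by have := modz_ge0 n (isT : m.+1%:Z != 0); have := ltz_pmod n (isT : 0 < m.+1%:Z); lia.
Qed.

Lemma theta_residues m c i j (g : 'I_m.+1 -> fps) : (0 < i)%N -> (0 < j)%N ->
  (forall r : 'I_m.+1, hasSum (fun n => tterm c i j (m.+1%:Z * n + r%:Z)) (g r)) ->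
  theta c i j = \sum_r g r.
Proof.
move=> i0 j0 Hg.
exact (hasSum_split (F := tterm c i j)
  (h := fun (r : 'I_m.+1) n => m.+1%:Z * n + r%:Z) (residues_bij m) Hg (hasSum_theta c i0 j0)).
Qed.

Lemma theta_residues2 c i j g0 g1 : (0 < i)%N -> (0 < j)%N ->
  hasSum (fun n => tterm c i j (2 * n)) g0 ->
  hasSum (fun n => tterm c i j (2 * n + 1)) g1 ->
  theta c i j = g0 + g1.
Proof.
move=> i0 j0 H0 H1.
rewrite (theta_residues (m := 1) (g := fun r => if val r == 0%N then g0 else g1)) //.
  by rewrite !big_ord_recl big_ord0 addr0.
by case=> [[|[|//]] lt_r] /=; [apply: hasSum_ext H0 => n; rewrite addr0 | apply: H1].
Qed.

Lemma theta_residues3 c i j g0 g1 g2 : (0 < i)%N -> (0 < j)%N ->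
  hasSum (fun n => tterm c i j (3 * n)) g0 ->
  hasSum (fun n => tterm c i j (3 * n + 1)) g1 ->
  hasSum (fun n => tterm c i j (3 * n + 2)) g2 ->
  theta c i j = g0 + g1 + g2.
Proof.
move=> i0 j0 H0 H1 H2.
rewrite (theta_residues (m := 2)
  (g := fun r => if val r == 0%N then g0 else if val r == 1%N then g1 else g2)) //.
  by rewrite !big_ord_recl big_ord0 addr0 addrA.
by case=> [[|[|[|//]]] lt_r] /=; [|apply: H1|apply: H2];
  apply: hasSum_ext H0 => n; rewrite addr0.
Qed.

(** Reduces every dissection below to a sign identity and an identity of quadratic exponents. *)
Lemma tterm_affine (a : int) e d c i j c' i' j' (n n' : int) : (0 < d)%N ->
  c' ^ n' = a * c ^ n ->
  ((i' * tri n' + j' * tri (- n')) = e + d * (i * tri n + j * tri (- n)))%N ->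
  tterm c' i' j' n' = mono a e * dil d (tterm c i j n).
Proof. by move=> d0 eq_c eq_e; rewrite /tterm dil_mono // monoM eq_c eq_e. Qed.

Lemma signz (c : int) (n : int) : c * c = 1 -> c ^ (2 * n) = 1.
Proof.
by move=> cc; rewrite -exprz_exp -[c ^ 2]/(c * c) cc exp1rz.
Qed.

Lemma signzD (c : int) (m n : int) : c * c = 1 -> c ^ (m + n) = c ^ m * c ^ n.
Proof. by move=> cc; rewrite exprzDr //; apply/unitrP; exists c. Qed.

Lemma signz_eq (c : int) (k m n : int) : c * c = 1 -> m = n + 2 * k -> c ^ m = c ^ n.
Proof. by move=> cc ->; rewrite signzD // signz // mulr1. Qed.

Ltac tri_gen := repeat match goal with |- context [tri ?x] =>
  let t := fresh "t" in have := triE x; move: (tri x) => t end.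

(** * Dissections of the particular theta functions *)

Local Notation phi c := (theta c 1 1).
Local Notation Om c := (theta c 1 5).
Local Notation A := (theta 1 1 2).
Local Notation E := (theta (-1) 1 2).
Local Notation psi := (theta 1 1 3).
Local Notation X := (mono 1 1).

(** From (3n)^2 = 9 n^2 and (3n+1)^2 = 1 + 3 (3n^2 + 2n); the residues 1 and 2 contribute equally by
    n -> -n. *)
Lemma phi_3dissection c : c * c = 1 ->
  phi c = dil 9 (phi c) + mono c 1 * dil 3 (Om c) + mono c 1 * dil 3 (Om c).
Proof.
move=> cc; rewrite -[dil 9 _]mul1r -mono10; apply: theta_residues3 => //.
- apply: (@hasSum_theta_affine _ _ _ _ _ _ id) => //; first by exists id.
  move=> n; apply: tterm_affine => //; last by tri_gen; lia.
  by rewrite mul1r; apply: (signz_eq (k := n)) => //; lia.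
- apply: (@hasSum_theta_affine _ _ _ _ _ _ (fun n => - n)) => //; first exact: bij_opp.
  move=> n; apply: tterm_affine => //; last by tri_gen; lia.
  by rewrite -[c in RHS]expr1z -signzD //; apply: (signz_eq (k := 2 * n)) => //; lia.
- apply: (@hasSum_theta_affine _ _ _ _ _ _ (fun n => n + 1)) => //; first exact: bij_shift.
  move=> n; apply: tterm_affine => //; last by tri_gen; lia.
  by rewrite -[c in RHS]expr1z -signzD //; apply: (signz_eq (k := n)) => //; lia.
Qed.

Lemma A_split : A = theta 1 5 7 + X * theta 1 1 11.
Proof.
rewrite -[theta 1 5 7]mul1r -mono10 -(dil_id (theta 1 5 7)) -(dil_id (theta 1 1 11)).
apply: theta_residues2 => //.
- apply: (@hasSum_theta_affine _ _ _ _ _ _ id) => //; first by exists id.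
  move=> n; apply: tterm_affine => //; last by tri_gen; lia.
  by rewrite !exp1rz.
- apply: (@hasSum_theta_affine _ _ _ _ _ _ (fun n => - n)) => //; first exact: bij_opp.
  move=> n; apply: tterm_affine => //; last by tri_gen; lia.
  by rewrite !exp1rz.
Qed.

(** The exponents 2n^2 - n with n = 1 mod 3 give the last term; those with n = 0 and n = 2 mod 3 are
    the two halves of A(q^3) in [A_split]. *)
Lemma psi_3dissection : psi = dil 3 A + X * dil 9 psi.
Proof.
rewrite A_split rmorphD rmorphM /= dil_mono // addrAC.
rewrite -[dil 3 (theta 1 5 7)]mul1r -mono10; apply: theta_residues3 => //.
- apply: (@hasSum_theta_affine _ _ _ _ _ _ id) => //; first by exists id.
  move=> n; apply: tterm_affine => //; last by tri_gen; lia.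
  by rewrite !exp1rz.
- apply: (@hasSum_theta_affine _ _ _ _ _ _ (fun n => - n)) => //; first exact: bij_opp.
  move=> n; apply: tterm_affine => //; last by tri_gen; lia.
  by rewrite !exp1rz.
- apply: (@hasSum_theta_affine _ _ _ _ _ _ (fun n => n + 1)) => //; first exact: bij_shift.
  move=> n; apply: tterm_affine => //; last by tri_gen; lia.
  by rewrite !exp1rz.
Qed.

Lemma Om_2dissection : Om (-1) = dil 8 A - X * dil 4 (Om 1).
Proof.
rewrite -mulNr -monoN -[dil 8 A]mul1r -mono10; apply: theta_residues2 => //.
- apply: (@hasSum_theta_affine _ _ _ _ _ _ id) => //; first by exists id.
  move=> n; apply: tterm_affine => //; last by tri_gen; lia.
  by rewrite signz // exp1rz.
- apply: (@hasSum_theta_affine _ _ _ _ _ _ (fun n => - n)) => //; first exact: bij_opp.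
  move=> n; apply: tterm_affine => //; last by tri_gen; lia.
  by rewrite signzD // signz // exp1rz.
Qed.

(** Pairs of integers split by the parity of their sum, each class being a copy of the square
    lattice turned by 45 degrees. *)
Lemma rotation_bij : bijective
  (fun p : bool * (int * int) => (p.2.1 + p.2.2 + p.1%:Z, p.2.1 - p.2.2)).
Proof.
exists (fun n : int * int => let b := odd (absz (n.1 + n.2)) in
  (b, (((n.1 + n.2 - b%:Z) %/ 2)%Z, ((n.1 - n.2 - b%:Z) %/ 2)%Z))) => [[b [x y]]|[m n]] /=.
  have -> : x + y + b%:Z + (x - y) = 2 * x + b%:Z by lia.
  have -> : odd (absz (2 * x + b%:Z)) = b by case: b; lia.
  by congr (_, (_, _)); lia.
by congr (_, _); case: (boolP (odd _)) => ?; lia.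
Qed.

(** The exponent 3m^2 - 2m + 3n^2 separates in rotated coordinates: m = x+y, n = x-y gives 4 times a
    sum of two pentagonal numbers, and m = x+y+1 gives 1 + 2(3x^2+2x) + 2(3y^2+2y). *)
Lemma Om_phi_2dissection :
  Om 1 * dil 3 (phi (-1)) = dil 4 E ^+ 2 + X * dil 2 (Om (-1)) ^+ 2.
Proof.
have FE := hasSum_mul (hasSum_theta 1 (isT : (0 < 1)%N) (isT : (0 < 5)%N))
  (hasSum_dil 3 (hasSum_theta (-1) (isT : (0 < 1)%N) (isT : (0 < 1)%N))).
have sq c i j d (s : int -> int) : (0 < i)%N -> (0 < j)%N -> bijective s ->
    hasSum (fun p : int * int => dil d (tterm c i j (s p.1)) * dil d (tterm c i j (s p.2)))
      (dil d (theta c i j) ^+ 2).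
  move=> i0 j0 s_bij; have H := hasSum_bij s_bij (hasSum_dil d (hasSum_theta c i0 j0)).
  by rewrite expr2; exact: (hasSum_mul H H).
apply: etrans (hasSum_split (h := fun (b : bool) p => (p.1 + p.2 + b%:Z, p.1 - p.2))
  (g := fun b : bool => if b then X * dil 2 (Om (-1)) ^+ 2 else dil 4 E ^+ 2)
  rotation_bij _ FE) _; last by rewrite big_bool addrC.
case.
  apply: hasSum_ext (hasSumMl _ (sq (-1) 1%N 5%N 2%N (fun n => - n) _ _ bij_opp)) => // -[x y].
  rewrite /= /tterm !dil_mono // !monoM; congr mono.
    rewrite exp1rz !mul1r -signzD //; apply: (signz_eq (k := - x)) => //; lia.
  by tri_gen; lia.
apply: hasSum_ext (sq (-1) 1%N 2%N 4%N id _ _ _) => // [[x y]|]; last by exists id.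
rewrite /= /tterm !dil_mono // !monoM; congr mono.
  rewrite exp1rz !mul1r -signzD //; apply: (signz_eq (k := y)) => //; lia.
by tri_gen; lia.
Qed.

(** * Product identities *)

Lemma theta00 c i j : c * c = 1 -> (0 < i)%N -> (0 < j)%N -> theta c i j 0%N = 1.
Proof.
move=> cc i0 j0; rewrite triple_product // !fpsM0 !pr00 ?mulr1 //.
by rewrite addn_gt0 i0.
Qed.

Lemma pr11 : pr (-1) 1 1 = pr (-1) 1 2 * pr (-1) 2 2.
Proof. exact: pr_split2. Qed.

Lemma pr22 : pr (-1) 2 2 = pr (-1) 2 4 * pr (-1) 4 4.
Proof. exact: pr_split2. Qed.

Lemma phi_pr c : c * c = 1 -> phi c = pr c 1 2 ^+ 2 * pr (-1) 2 2.
Proof. by move=> cc; rewrite triple_product // expr2. Qed.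

Lemma E_pr : E = pr (-1) 1 1.
Proof. by rewrite triple_product // [RHS]pr_split3. Qed.

Lemma psi_pr : psi * pr (-1) 1 2 = pr (-1) 2 2.
Proof.
have s : pr 1 1 2 = pr 1 1 4 * pr 1 3 4 by apply: pr_split2.
by rewrite triple_product // -s mulrAC pr_conj // pr22.
Qed.

Lemma Om_pr : Om (-1) = pr (-1) 1 6 * pr (-1) 5 6 * pr (-1) 6 6.
Proof. exact: triple_product. Qed.

Lemma phi_phi : phi 1 * phi (-1) = dil 2 (phi (-1)) ^+ 2.
Proof.
rewrite !phi_pr // rmorphM rmorphXn /= !dil_pr // -[(2 * 1)%N]/2%N -[(2 * 2)%N]/4%N.
have conj := pr_conj 1 (isT : (0 < 2)%N).
transitivity ((pr 1 1 2 * pr (-1) 1 2) ^+ 2 * pr (-1) 2 2 ^+ 2); first by ring.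
by rewrite conj pr22 -[(2 * 1)%N]/2%N -[(2 * 2)%N]/4%N; ring.
Qed.

(** Expresses the quotient of (-q; q^2) by (q; q^2), from which the Schur product is built, as
    phi(q) / phi(-q^2). *)
Lemma phi_pr_swap : phi 1 * pr (-1) 1 2 = dil 2 (phi (-1)) * pr 1 1 2.
Proof.
rewrite !phi_pr // rmorphM rmorphXn /= !dil_pr // -[(2 * 1)%N]/2%N -[(2 * 2)%N]/4%N.
have conj := pr_conj 1 (isT : (0 < 2)%N).
transitivity ((pr 1 1 2 * pr (-1) 1 2) * pr 1 1 2 * pr (-1) 2 2); first by ring.
by rewrite conj pr22 -[(2 * 1)%N]/2%N -[(2 * 2)%N]/4%N; ring.
Qed.

Lemma phi_psi : phi (-1) * psi = E * dil 2 E.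
Proof.
rewrite E_pr dil_pr // muln1 phi_pr // pr11 -{2}psi_pr; ring.
Qed.

Lemma dil2_E_sqr_Om : dil 2 E ^+ 2 * Om (-1) = phi (-1) * psi * dil 3 psi.
Proof.
have u3 : pr (-1) 3 6 0%N = 1 by apply: pr00.
apply: (lreg1 u3); rewrite phi_psi E_pr Om_pr dil_pr // muln1.
have := congr1 (dil 3) psi_pr; rewrite rmorphM /= !dil_pr //.
rewrite -[(3 * 1)%N]/3%N -[(3 * 2)%N]/6%N => psi3.
transitivity (pr (-1) 1 1 * pr (-1) 2 2 * (dil 3 psi * pr (-1) 3 6)); last by ring.
rewrite psi3 pr11 (pr_split3 (-1) 1 (m := 2)) //.
by rewrite -[(3 * 2)%N]/6%N -[(1 + 2)%N]/3%N -[(1 + 2 * 2)%N]/5%N; ring.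
Qed.

(** Both sides equal E(q^3) E(q^6). This relation produces the sign in the 3-dissection of phi(-q)
    psi(q). *)
Lemma Om_A : Om (-1) * A = dil 3 (phi (-1)) * dil 3 psi.
Proof.
rewrite -rmorphM /= phi_psi rmorphM /= dil_dil // E_pr !dil_pr // !muln1.
rewrite Om_pr triple_product //.
have s1 : pr (-1) 1 3 = pr (-1) 1 6 * pr (-1) 4 6 by apply: pr_split2.
have s2 : pr (-1) 2 3 = pr (-1) 2 6 * pr (-1) 5 6 by apply: pr_split2.
have c1 : pr 1 1 3 * pr (-1) 1 3 = pr (-1) 2 6 by apply: pr_conj.
have c2 : pr 1 2 3 * pr (-1) 2 3 = pr (-1) 4 6 by apply: pr_conj.
have u0 : (pr (-1) 2 6 * pr (-1) 4 6) 0%N = 1 by rewrite fpsM0 !pr00.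
apply: (lreg1 u0).
transitivity ((pr 1 1 3 * pr (-1) 1 3) * (pr 1 2 3 * pr (-1) 2 3) * (pr (-1) 3 3 * pr (-1) 6 6)).
  by rewrite s1 s2; ring.
by rewrite c1 c2; ring.
Qed.

(** * The generating function *)

Definition fps_of_poly (p : {poly int}) : fps := fun n => p`_n.

Fact fps_of_poly_zmod : zmod_morphism fps_of_poly.
Proof. by move=> p r; apply: fpsP => n; rewrite fpsD fpsN /fps_of_poly coefB. Qed.
Fact fps_of_poly_monoid : monoid_morphism fps_of_poly.
Proof.
split=> [|p r]; apply: fpsP => n; first by rewrite /fps_of_poly coef1.
by rewrite fpsM /fps_of_poly coefM.
Qed.
HB.instance Definition _ := GRing.isZmodMorphism.Build _ _ fps_of_poly fps_of_poly_zmod.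
HB.instance Definition _ := GRing.isMonoidMorphism.Build _ _ fps_of_poly fps_of_poly_monoid.

Lemma fps_of_polyXn k : fps_of_poly 'X^k = mono 1 k.
Proof. by apply: fpsP => n; rewrite /fps_of_poly coefXn /mono; case: eqP. Qed.

Lemma schur9_numE M : fps_of_poly (schur9_num M) = pprod 1 1 2 M * pprod (-1) 9 18 M.
Proof.
rewrite /schur9_num big_add1 /= big_mkord rmorph_prod -big_split; apply: eq_bigr => k _ /=.
rewrite rmorphM rmorphD rmorphB rmorph1 /= !fps_of_polyXn monoN.
by congr ((1 + mono _ _) * (1 - mono _ _)); lia.
Qed.

Lemma schur9_denE M : fps_of_poly (schur9_den M) = pprod 1 9 18 M * pprod (-1) 1 2 M.
Proof.
rewrite /schur9_den big_add1 /= big_mkord rmorph_prod -big_split; apply: eq_bigr => k _ /=.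
rewrite rmorphM rmorphD rmorphB rmorph1 /= !fps_of_polyXn monoN.
by congr ((1 + mono _ _) * (1 - mono _ _)); lia.
Qed.

Definition S9 : fps := S9bar.

Lemma S9_product : pr 1 9 18 * pr (-1) 1 2 * S9 = pr 1 1 2 * pr (-1) 9 18.
Proof.
apply: (tends_uniq (u := fun M => fps_of_poly (schur9_den M) * S9)).
  apply: tendsM (tends_cst _).
  apply: (tends_ext (u := fun M => pprod 1 9 18 M * pprod (-1) 1 2 M)).
    by move=> M; rewrite schur9_denE.
  by apply: tendsM; apply: tends_pprod.
have num_tends : tends (fun M => fps_of_poly (schur9_num M)) (pr 1 1 2 * pr (-1) 9 18).
  apply: (tends_ext (u := fun M => pprod 1 1 2 M * pprod (-1) 9 18 M)).
    by move=> M; rewrite schur9_numE.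
  by apply: tendsM; apply: tends_pprod.
move=> n; have [N numN] := num_tends n; exists (maxn n N) => M.
rewrite geq_max => /andP[le_nM /numN numM]; apply: eqf_trans numM => k le_kn.
(* For M >= n the expansion of the M-th partial quotient agrees with [S9] up to degree n, and
   [expandP] says that it solves denominator times series = numerator. *)
rewrite fpsM -[RHS](expandP _ k (schur9_den0 M)); apply: eq_bigr => i _.
by rewrite S9bar_stable // (leq_trans (leq_subr _ _)) // (leq_trans le_kn).
Qed.

Lemma S9_theta :
  S9 * dil 2 (phi (-1)) * dil 9 (phi 1) = phi 1 * dil 18 (phi (-1)).
Proof.
have c1 : (pr 1 1 2 * pr (-1) 9 18) 0%N = 1 by rewrite fpsM0 !pr00.
apply: (lreg1 c1).
have := congr1 (dil 9) phi_pr_swap; rewrite !rmorphM /= !dil_pr // dil_dil //.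
rewrite -[(9 * 1)%N]/9%N -[(9 * 2)%N]/18%N => shift9.
transitivity (S9 * (dil 2 (phi (-1)) * pr 1 1 2) * (dil 9 (phi 1) * pr (-1) 9 18)); first by ring.
rewrite shift9 -phi_pr_swap.
transitivity ((pr 1 9 18 * pr (-1) 1 2 * S9) * phi 1 * dil 18 (phi (-1))); first by ring.
by rewrite S9_product; ring.
Qed.

(** * The progressions modulo 6 *)

Lemma sect2_0 f g : sect 2 0 (dil 2 f + X * dil 2 g) = f.
Proof.
rewrite raddfD /= sect0_dil // -[X]/(mono 1 (2 * 0 + 1)) sect_mono //.
by rewrite addr0.
Qed.

Lemma sect2_1 f g : sect 2 1 (dil 2 f + X * dil 2 g) = g.
Proof.
rewrite raddfD /= sect_dil // -[X]/(mono 1 (2 * 0 + 1)) sect_mono //.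
by rewrite mono10 mul1r add0r.
Qed.

Lemma sect3 f g h r : (r < 3)%N ->
  sect 3 r (dil 3 f + X * dil 3 g + X ^+ 2 * dil 3 h) =
    if r is 0%N then f else if r is 1%N then g else h.
Proof.
have E1 : X = mono 1 (3 * 0 + 1) by [].
have E2 : X ^+ 2 = mono 1 (3 * 0 + 2) by rewrite monoX expr1n.
move=> lt_r; rewrite E2 {1}E1 !raddfD /= !sect_mono // !mono10 !mul1r.
case: r lt_r => [|[|[|//]]] _ /=.
- by rewrite sect0_dil // !addr0.
- by rewrite sect_dil // add0r addr0.
- by rewrite sect_dil // !add0r.
Qed.

Section Progressions.

Let P := dil 6 (phi (-1)).
Let C := dil 2 (Om (-1)).
Let F := dil 3 (phi 1).
Let D := P ^+ 3 - X ^+ 2 * C ^+ 3 *+ 8.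

(* With a = dil 18 (phi (-1)) and t = 2 q^2 dil 6 (Om (-1)), dil 2 (phi (-1)) = a - t *)
(* is cleared by a^2 + a t + t^2.                                                    *)
Lemma S9_cleared :
  S9 * dil 3 (F * D) =
    dil 3 (P * (F * P ^+ 2 + X * Om 1 * C * P *+ 4)) +
    X * dil 3 (P * (Om 1 * P ^+ 2 *+ 2 + F * X * C ^+ 2 *+ 4)) +
    X ^+ 2 * dil 3 (P * (C * P * F *+ 2 + X * Om 1 * C ^+ 2 *+ 8)).
Proof.
have X3 : dil 3 X = X ^+ 3 by rewrite dil_mono // monoX expr1n.
have phi2 : dil 2 (phi (-1)) = dil 3 P - X ^+ 2 * dil 3 C *+ 2.
  rewrite {1}phi_3dissection // !rmorphD !rmorphM /= !dil_dil // dil_mono //.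
  by rewrite monoX expr1n monoN; ring.
have phi1 : phi 1 = dil 3 F + X * dil 3 (Om 1) *+ 2.
  by rewrite {1}phi_3dissection // dil_dil //; ring.
have th := S9_theta.
have F9 : dil 9 (phi 1) = dil 3 F by rewrite dil_dil.
have P18 : dil 18 (phi (-1)) = dil 3 P by rewrite dil_dil.
rewrite F9 P18 phi2 phi1 in th.
rewrite /D.
rewrite !(rmorphD, rmorphN, rmorphM, rmorphXn, rmorphMn) /= X3.
set p := dil 3 P in th *; set c := dil 3 C in th *; set f := dil 3 F in th *.
transitivity (S9 * (p - X ^+ 2 * c *+ 2) * f *
  (p ^+ 2 + X ^+ 2 * c * p *+ 2 + X ^+ 4 * c ^+ 2 *+ 4)); first by ring.
by rewrite th; ring.
Qed.

Lemma S9_sect0 : sect 3 0 S9 * (F * D) = P * (F * P ^+ 2 + X * Om 1 * C * P *+ 4).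
Proof. by rewrite -(sectM S9 (F * D) (isT : 0 < 3)%N) S9_cleared sect3. Qed.

Lemma S9_sect1 :
  sect 3 1 S9 * (F * D) = P * (Om 1 * P ^+ 2 *+ 2 + F * X * C ^+ 2 *+ 4).
Proof. by rewrite -(sectM S9 (F * D) (isT : 1 < 3)%N) S9_cleared sect3. Qed.

Lemma S9_sect2 :
  sect 3 2 S9 * (F * D) = P * (C * P * F *+ 2 + X * Om 1 * C ^+ 2 *+ 8).
Proof. by rewrite -(sectM S9 (F * D) (isT : 2 < 3)%N) S9_cleared sect3. Qed.

Let b := dil 3 (phi (-1)).
Let z := Om (-1).
Let y := dil 2 E ^+ 2.
Let d := b ^+ 3 - X * z ^+ 3 *+ 8.
Let W := Om 1 * dil 3 (phi (-1)).

Let P0 : P 0%N = 1. Proof. by rewrite /P dil00 theta00. Qed.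

(** Multiplying by phi(-q^3) turns [F] into an even series and [Om 1] into [W], whose parity split
    is [WE]. As [P], [C] and [D] are even, the sections modulo 2 can then be read off. *)
Let Fphi : F * dil 3 (phi (-1)) = P ^+ 2.
Proof. by rewrite /F -rmorphM /= phi_phi rmorphXn /= dil_dil. Qed.

Let PE : P = dil 2 b. Proof. by rewrite /b dil_dil. Qed.
Let WE : W = dil 2 y + X * dil 2 (z ^+ 2).
Proof. by rewrite /W Om_phi_2dissection !rmorphXn /= dil_dil. Qed.
Let DE : D = dil 2 d.
Proof.
rewrite /D /d PE !(rmorphD, rmorphN, rmorphM, rmorphXn, rmorphMn) /= dil_mono //.
by rewrite monoX expr1n.
Qed.

Let X2 : X ^+ 2 = dil 2 X.
Proof. by rewrite dil_mono // monoX expr1n. Qed.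

Lemma S9_sect_6_3 : sect 6 3 S9 * d = y * z *+ 4.
Proof.
have H : sect 3 0 S9 * D = P ^+ 3 + X * W * C *+ 4.
  have P2 : (P ^+ 2) 0%N = 1 by rewrite expr2 fpsM0 P0.
  apply: (lreg1 P2); rewrite -{1}Fphi.
  transitivity (sect 3 0 S9 * (F * D) * dil 3 (phi (-1))); first by ring.
  rewrite S9_sect0.
  transitivity (P * (F * dil 3 (phi (-1)) * P ^+ 2 + X * W * C * P *+ 4)).
    by rewrite /W; ring.
  by rewrite Fphi; ring.
have -> : sect 6 3 S9 = sect 2 1 (sect 3 0 S9) by rewrite sect_sect.
rewrite -sectM // -DE H WE PE.
transitivity (sect 2 1 (dil 2 (b ^+ 3 + X * z ^+ 3 *+ 4) + X * dil 2 (y * z *+ 4))).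
  congr (sect 2 1 _); rewrite /C -/z !(rmorphD, rmorphM, rmorphXn, rmorphMn) /= -X2; ring.
by rewrite sect2_1.
Qed.

Lemma S9_sect_6_1 : sect 6 1 S9 * d = y * b *+ 2.
Proof.
have H : sect 3 1 S9 * D = P * (W *+ 2 + X * C ^+ 2 *+ 4).
  have P2 : (P ^+ 2) 0%N = 1 by rewrite expr2 fpsM0 P0.
  apply: (lreg1 P2); rewrite -{1}Fphi.
  transitivity (sect 3 1 S9 * (F * D) * dil 3 (phi (-1))); first by ring.
  rewrite S9_sect1.
  transitivity (P * (W * P ^+ 2 *+ 2 + (F * dil 3 (phi (-1))) * X * C ^+ 2 *+ 4)).
    by rewrite /W; ring.
  by rewrite Fphi; ring.
have -> : sect 6 1 S9 = sect 2 0 (sect 3 1 S9) by rewrite sect_sect.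
rewrite -sectM // -DE H WE PE.
transitivity (sect 2 0 (dil 2 (y * b *+ 2) + X * dil 2 (b * z ^+ 2 *+ 6))).
  by congr (sect 2 0 _); rewrite /C -/z !(rmorphD, rmorphM, rmorphXn, rmorphMn) /=; ring.
by rewrite sect2_0.
Qed.

Lemma S9_sect_6_5 : sect 6 5 S9 * (d * b) = y * z ^+ 2 *+ 8.
Proof.
have H : sect 3 2 S9 * (D * P) = C * P ^+ 3 *+ 2 + X * W * C ^+ 2 *+ 8.
  apply: (lreg1 P0).
  transitivity (sect 3 2 S9 * D * P ^+ 2); first by ring.
  rewrite -Fphi.
  transitivity (sect 3 2 S9 * (F * D) * dil 3 (phi (-1))); first by ring.
  rewrite S9_sect2.
  transitivity (P * (C * P * (F * dil 3 (phi (-1))) *+ 2 + X * W * C ^+ 2 *+ 8)).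
    by rewrite /W; ring.
  by rewrite Fphi; ring.
have -> : sect 6 5 S9 = sect 2 1 (sect 3 2 S9) by rewrite sect_sect.
rewrite -sectM // rmorphM /= -DE -PE H WE PE.
transitivity (sect 2 1 (dil 2 (z * b ^+ 3 *+ 2 + X * z ^+ 4 *+ 8) + X * dil 2 (y * z ^+ 2 *+ 8))).
  by congr (sect 2 1 _); rewrite /C -/z !(rmorphD, rmorphM, rmorphXn, rmorphMn) /= -X2; ring.
by rewrite sect2_1.
Qed.


End Progressions.
(** * Congruences *)

(** By [phi_3dissection], phi(q) and phi(q^9) agree modulo 2, so the parity of a coefficient of
    positive index n descends to index n/9 or is even at once. *)
Lemma phi_odd c : c * c = 1 -> exists w, phi c = 1 + w *+ 2.
Proof.
move=> cc; have even n : (0 < n)%N -> (2 %| (phi c : fps) n)%Z.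
  elim/ltn_ind: n => n IH n_gt0; rewrite phi_3dissection // -addrA -mulr2n.
  rewrite fpsD fpsMn; apply: rpredD; last first.
    by apply/dvdzP; exists ((mono c 1 * dil 3 (Om c)) n); rewrite mulr_natr.
  rewrite /dil; case: ifP => // /dvdnP[k def_n].
  by rewrite def_n mulnK // IH // ; lia.
pose w : fps := fun n => if n == 0%N then 0 else ((phi c : fps) n %/ 2)%Z.
exists w; apply: fpsP => n; rewrite /w fpsD fpsMn fps1; case: eqP => [->|/eqP n0].
  by rewrite theta00 // mul0rn addr0.
have /dvdzP[k ->] : (2 %| (phi c : fps) n)%Z by rewrite even // lt0n.
by rewrite add0r mulzK // mulr_natr.
Qed.

Section Congruences.

Let b := dil 3 (phi (-1)).
Let z := Om (-1).
Let y := dil 2 E ^+ 2.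
Let d := b ^+ 3 - X * z ^+ 3 *+ 8.

Let b_odd : exists w, b = 1 + w *+ 2.
Proof.
have [w phiE] := phi_odd (erefl : (-1) * (-1) = 1 :> int); exists (dil 3 w).
by rewrite /b phiE rmorphD rmorph1 /= rmorphMn.
Qed.

Let d_inv : exists e, d * e = 1.
Proof.
apply: inv1; rewrite /d fpsD fpsN fpsMn fpsM0 /mono mul0r mul0rn subr0.
by rewrite !exprS expr0 !fpsM0 /b dil00 theta00.
Qed.

Lemma S9_6_1_mod8 : exists h, sect 6 1 S9 = y *+ 2 + h *+ 8.
Proof.
have [w bE] := b_odd; have [e de] := d_inv.
(* With b = 1 + 2w one has b^3 - b = 4 b (w + w^2); this is (b - d)/4 times y/d. *)
exists (y * e * (X * z ^+ 3 *+ 2 - b * (w + w ^+ 2))).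
transitivity (sect 6 1 S9 * d * e); first by rewrite -mulrA de mulr1.
rewrite S9_sect_6_1 -/b -/y.
transitivity (y * (d * e) *+ 2 + y * e * (b - d) *+ 2); first by ring.
by rewrite de /d bE; ring.
Qed.

Lemma S9_6_3_mod32 : exists h, sect 6 3 S9 = y * z * b *+ 4 + h *+ 32.
Proof.
have [w bE] := b_odd; have [e de] := d_inv.
(* The last factor is (1 - b d)/8, from b^4 = (1 + 2w)^4 = 1 mod 8; so 1/d is b modulo 8. *)
exists (y * z * e * (X * b * z ^+ 3 - (w + w ^+ 2 *+ 3 + w ^+ 3 *+ 4 + w ^+ 4 *+ 2))).
transitivity (sect 6 3 S9 * d * e); first by rewrite -mulrA de mulr1.
rewrite S9_sect_6_3 -/z -/y.
transitivity (y * z * b * (d * e) *+ 4 + y * z * e * (1 - b * d) *+ 4); first by ring.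
by rewrite de /d bE; ring.
Qed.

Lemma S9_6_5_mod64 : exists h, sect 6 5 S9 = y * z ^+ 2 *+ 8 + h *+ 64.
Proof.
have [w bE] := b_odd; have [e de] := d_inv.
have [b' bb'] : exists b', b * b' = 1 by apply: inv1; rewrite /b dil00 theta00.
exists (y * z ^+ 2 * e * b' * (X * b * z ^+ 3 - (w + w ^+ 2 *+ 3 + w ^+ 3 *+ 4 + w ^+ 4 *+ 2))).
transitivity (sect 6 5 S9 * (d * b) * (e * b')).
  rewrite -[LHS]mulr1 -[in LHS](mulr1 1) -{1}de -bb'; ring.
rewrite S9_sect_6_5 -/z -/y.
transitivity (y * z ^+ 2 * ((d * e) * (b * b')) *+ 8 +
    y * z ^+ 2 * e * b' * (1 - b * d) *+ 8).
  by ring.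
by rewrite de bb' /d bE; ring.
Qed.

Lemma yzb_phi_psi : y * z * b = phi (-1) * psi * dil 3 (psi * phi (-1)).
Proof. by rewrite /y /z dil2_E_sqr_Om rmorphM /= /b; ring. Qed.

Lemma phi_psi_3dissection :
  psi * phi (-1) = dil 3 (b * A) + X * dil 3 (- (b * dil 3 psi)) +
    X ^+ 2 * dil 3 (- (z * dil 3 psi *+ 2)).
Proof.
have phi3 : phi (-1) = dil 3 b - X * dil 3 z *+ 2.
  by rewrite {1}phi_3dissection // /b dil_dil // monoN; ring.
have psi3 : psi = dil 3 A + X * dil 3 (dil 3 psi) by rewrite dil_dil // {1}psi_3dissection.
(* The right side is what multiplying the two dissections gives at index 1; [Om_A] replaces z A by b
   psi(q^3) and flips the sign. *)
have -> : - (b * dil 3 psi) = b * dil 3 psi - z * A *+ 2.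
  by rewrite /z Om_A -/b; ring.
rewrite phi3 {1}psi3 !(rmorphD, rmorphN, rmorphM, rmorphMn) /=; ring.
Qed.

Lemma sect3_yzb r : (r < 3)%N -> sect 3 r (y * z * b) =
  sect 3 r (psi * phi (-1)) * (psi * phi (-1)).
Proof. by move=> lt_r; rewrite yzb_phi_psi [phi _ * _]mulrC sectM. Qed.

Lemma sect_yzb_1 : sect 3 1 (y * z * b) = - (y * z * b).
Proof.
rewrite sect3_yzb // {1}phi_psi_3dissection sect3 // {2}/b /y /z dil2_E_sqr_Om; ring.
Qed.

Lemma sect_yzb_2 : sect 3 2 (y * z * b) = - (y * z ^+ 2 *+ 2).
Proof.
rewrite sect3_yzb // {1}phi_psi_3dissection sect3 //.
have -> : y * z ^+ 2 = y * z * z by ring.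
have yz : y * z = phi (-1) * psi * dil 3 psi := dil2_E_sqr_Om.
by rewrite yz; ring.
Qed.

Lemma S9_18_9_mod32 : exists h, sect 18 9 S9 = - sect 6 3 S9 + h *+ 32.
Proof.
have [h hE] := S9_6_3_mod32; exists (h + sect 3 1 h).
have -> : sect 18 9 S9 = sect 3 1 (sect 6 3 S9) by rewrite sect_sect.
by rewrite hE raddfD !raddfMn /= sect_yzb_1; ring.
Qed.

(** The two sides have leading terms - 8 y z^2 and 8 y z^2, which agree modulo 16. *)
Lemma S9_18_15_mod16 : exists h, sect 18 15 S9 = sect 6 5 S9 + h *+ 16.
Proof.
have [h hE] := S9_6_3_mod32; have [h' hE'] := S9_6_5_mod64.
exists (sect 3 2 h *+ 2 - h' *+ 4 - y * z ^+ 2).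
have -> : sect 18 15 S9 = sect 3 2 (sect 6 3 S9) by rewrite sect_sect.
by rewrite hE hE' raddfD !raddfMn /= sect_yzb_2; ring.
Qed.

(** The odd part of a square is twice the even part times the odd part of the series. *)
Lemma sect_sqr_even f : exists h, sect 2 1 (f ^+ 2) = h *+ 2.
Proof.
exists (sect 2 0 f * sect 2 1 f); set f0 := sect 2 0 f; set f1 := sect 2 1 f.
have fE : f = dil 2 f0 + X * dil 2 f1.
  by rewrite {1}(dissection f (isT : 0 < 2)%N) !big_ord_recl big_ord0 /= mono10 mul1r addr0.
have X2 : dil 2 X = X ^+ 2 by rewrite dil_mono // monoX expr1n.
rewrite -[RHS](sect2_1 (f0 ^+ 2 + X * f1 ^+ 2)); congr (sect 2 1 _).
by rewrite fE !(rmorphD, rmorphM, rmorphXn, rmorphMn) /= X2; ring.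
Qed.

Lemma sect_yzz : exists h, sect 4 3 (y * z ^+ 2) = h *+ 4.
Proof.
have [h hE] := sect_sqr_even E.
exists (- (h * (dil 2 A * Om 1))).
have -> : sect 4 3 (y * z ^+ 2) = sect 2 1 (sect 2 1 (y * z ^+ 2)) by rewrite sect_sect.
have X2 : dil 2 X = X ^+ 2 by rewrite dil_mono // monoX expr1n.
have -> : y * z ^+ 2 = dil 2 (E ^+ 2 * (dil 4 A ^+ 2 + X * dil 2 (Om 1) ^+ 2)) +
    X * dil 2 (- (E ^+ 2 * dil 2 (dil 2 A * Om 1) *+ 2)).
  rewrite /y /z Om_2dissection !(rmorphD, rmorphN, rmorphM, rmorphXn, rmorphMn) /= X2.
  by rewrite !dil_dil //; ring.
rewrite sect2_1 raddfN raddfMn /= sectM // hE; ring.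
Qed.

Lemma S9_24_23_mod32 : exists h, sect 24 23 S9 = h *+ 32.
Proof.
have [h hE] := S9_6_5_mod64; have [h' hE'] := sect_yzz.
exists (h' + sect 4 3 h *+ 2).
have -> : sect 24 23 S9 = sect 4 3 (sect 6 5 S9) by rewrite sect_sect.
by rewrite hE raddfD !raddfMn /= hE'; ring.
Qed.

Lemma S9_12_7_mod8 : exists h, sect 12 7 S9 = h *+ 8.
Proof.
have [h hE] := S9_6_1_mod8; exists (sect 2 1 h).
have -> : sect 12 7 S9 = sect 2 1 (sect 6 1 S9) by rewrite sect_sect.
by rewrite hE raddfD !raddfMn /= /y -rmorphXn sect_dil // mul0rn add0r.
Qed.

Lemma S9_6_5_mod8 : exists h, sect 6 5 S9 = h *+ 8.
Proof.
have [h ->] := S9_6_5_mod64; exists (y * z ^+ 2 + h *+ 8); ring.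
Qed.

End Congruences.

(** * Iteration over powers of 3 and the four congruences *)

Lemma eqz_modI (m a b k : int) : a = b + k * m -> (a = b %[mod m])%Z.
Proof. by move=> ->; rewrite addrC modzMDl. Qed.

Lemma S9bar_sect m r n : S9bar (m * n + r) = sect m r S9 n.
Proof. by []. Qed.

Lemma S9bar_6_3 n alpha : exists k : int,
  S9bar (6 * n + 3) = (-1) ^+ alpha * S9bar (3 ^ alpha * (6 * n + 3)) + k * 16.
Proof.
elim: alpha n => [|alpha IH] n; first by exists 0; rewrite mul1r mul1n mul0r addr0.
(* The progression is stable under tripling: 3(6n+3) = 6(3n+1) + 3. *)
have [k kE] := IH (3 * n + 1)%N; have [h hE] := S9_18_9_mod32.
have := congr1 (@^~ n) hE; rewrite /= fpsD fpsN fpsMn -!S9bar_sect => En.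
have e1 : (6 * (3 * n + 1) + 3 = 18 * n + 9)%N by lia.
have e2 : (3 ^ alpha.+1 * (6 * n + 3) = 3 ^ alpha * (18 * n + 9))%N.
  by rewrite expnS; lia.
exists (h n * 2 - k); rewrite e2 exprS mulN1r mulNr.
by rewrite e1 in kE; lia.
Qed.

Theorem theorem3p3 (n alpha : nat) :
  [/\ (S9bar (12 * n + 7) = 0 %[mod 8])%Z,
      (S9bar (6 * n + 3)
         = (-1) ^+ alpha * S9bar (3 ^ alpha * (6 * n + 3)) %[mod 16])%Z,
      (S9bar (6 * n + 5) = S9bar (3 ^ alpha * (6 * n + 5)) %[mod 16])%Z
    & (S9bar (24 * n + 23) = 0 %[mod 32])%Z].
Proof.
split.
- have [h hE] := S9_12_7_mod8; apply: (@eqz_modI _ _ _ (h n)).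
  by rewrite S9bar_sect hE fpsMn add0r mulr_natr.
- by have [k kE] := S9bar_6_3 n alpha; apply: eqz_modI kE.
- case: alpha => [|alpha]; first by rewrite mul1n.
  have [h hE] := S9_18_15_mod16; have [h' hE'] := S9_6_5_mod8.
  (* After one tripling, 3(6n+5) = 6(3n+2) + 3 lies in the progression already handled. *)
  have [k kE] := S9bar_6_3 (3 * n + 2) alpha.
  have := congr1 (@^~ n) hE; rewrite /= fpsD fpsMn -!S9bar_sect => En.
  have := congr1 (@^~ n) hE'; rewrite /= fpsMn -!S9bar_sect => En'.
  have e1 : (6 * (3 * n + 2) + 3 = 18 * n + 15)%N by lia.
  have e2 : (3 ^ alpha.+1 * (6 * n + 5) = 3 ^ alpha * (18 * n + 15))%N.
    by rewrite expnS; lia.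
  rewrite e1 in kE; rewrite e2.
  (* The sign is harmless here: the values are multiples of 8 ([S9_6_5_mod8]), and such a number
     equals its opposite modulo 16. *)
  rewrite -signr_odd in kE; case: (odd alpha) kE; rewrite /= ?expr1 ?expr0 => kE.
    by apply: (@eqz_modI _ _ _ (h' n - k + h n)); lia.
  by apply: (@eqz_modI _ _ _ (k - h n)); lia.
- have [h hE] := S9_24_23_mod32; apply: (@eqz_modI _ _ _ (h n)).
  by rewrite S9bar_sect hE fpsMn add0r mulr_natr.
Qed.
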